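(* Let $E(1,6)$ be realized as the subalgebra $\iota(K(1,6))$ of $K(1,6)$. The linear map $\Psi:E(1,6)\to E(4,4)$ determined by the prescribed values $\Psi(\iota(\xi_I))$ for $|I|\le 3$ (listed in the context) and by $$\Psi(\iota(t^n\xi_I))=2^n x_1^n\,\Psi(\iota(\xi_I))\qquad (n\ge1,\ |I|\le 3)$$ is an embedding of Lie superalgebras (i.e. an injective Lie superalgebra homomorphism).
   Context: All spaces are over $\mathbb C$. **$K(1,6)$.** $K(1,6)=\mathbb C[[t]]\otimes\bigwedge(\xi_1,\xi_2,\xi_3,\eta_1,\eta_2,\eta_3)$ ($t$ even, $\xi_i,\eta_i$ odd, $p$ = parity) with bracket $$[f,g]=(2-E)f\,\frac{\partial g}{\partial t}-\frac{\partial f}{\partial t}(2-E)g+(-1)^{p(f)}\sum_{i=1}^3\Big(\frac{\partial f}{\partial\xi_i}\frac{\partial g}{\partial\eta_i}+\frac{\partial f}{\partial\eta_i}\frac{\partial g}{\partial\xi_i}\Big),\quad E=\sum_{i=1}^3\Big(\xi_i\frac{\partial}{\partial\xi_i}+\eta_i\frac{\partial}{\partial\eta_i}\Big).$$ Put $\xi_4=\eta_1$, $\eta_4=\xi_1$, so the odd generators are also $\xi_2,\xi_3,\xi_4,\eta_2,\eta_3,\eta_4$. Write $\xi_{\bar i}=\eta_i$ and $\bar{\bar i}=i$. For a sequence $I=(i_1,\dots,i_k)$ with distinct entries in $\{2,3,4,\bar2,\bar3,\bar4\}$ let $|I|=k$, $\xi_I=\xi_{i_1}\cdots\xi_{i_k}$,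 $\bar I=(\bar i_1,\dots,\bar i_k)$, and let $\xi_I^\#$ be the unique signed monomial with $\xi_{\bar I}\,\xi_I^\#=\xi_2\xi_3\xi_4\eta_2\eta_3\eta_4$. **$A$ and $\iota$.** $A:K(1,6)\to K(1,6)$ is the (continuous) linear operator with $A(t^n\xi_I)=(-1)^{|I|(|I|+1)/2}(\partial_t^{3-|I|}t^n)\,\xi_I^\#$, where $\partial_t^{-1}=\int_0^t$ and negative powers are iterated integrals; $\iota(f)=f+A(f)$. The image $\iota(K(1,6))$ is a Lie subalgebra of $K(1,6)$ isomorphic to $E(1,6)$; it is (topologically) spanned by the elements $\iota(t^n\xi_I)$ with $n\ge0$, $|I|\le3$. **$E(4,4)$.** Its even part is $W_4$, the Lie algebra of vector fields $\sum_{i=1}^4P_i\partial_{x_i}$, $P_i\in\mathbb C[[x_1,\dots,x_4]]$. Its odd part is the space of differential 1-forms in $x_1,\dots,x_4$ with coefficients in $\mathbb C[[x_1,\dots,x_4]]$, on which $X\in W_4$ acts by $[X,\omega]=L_X\omega-\frac12(\operatorname{div}X)\,\omega$. For odd $\omega_1,\omega_2$, $[\omega_1,\omega_2]=d\omega_1\wedge\omega_2+\omega_1\wedge d\omega_2$, where a 3-form is identified with the vector field $X$ such that the 3-form equals $i_X(dx_1\wedge dx_2\wedge dx_3\wedge dx_4)$. **Values of $\Psi$ for $n=0$.** For every cyclic permutation $(i,j,k)$ of $(2,3,4)$ (and, in the line for $\xi_i\eta_j$, for all $i\ne j$ in $\{2,3,4\}$): - $\Psi(\iota(1))=\partial_{x_1}$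 - $\Psi(\iota(\eta_i\eta_j))=\partial_{x_k}$ - $\Psi(\iota(\eta_i))=\frac{\sqrt2}{2}dx_i$ - $\Psi(\iota(\eta_i\eta_j\eta_k))=-\sqrt2\,dx_1$ - $\Psi(\iota(\xi_i\eta_j))=x_j\partial_{x_i}$ - $\Psi(\iota(\xi_i\eta_i))=-x_j\partial_{x_j}-x_k\partial_{x_k}$ - $\Psi(\iota(\xi_i))=\frac{\sqrt2}{2}(-x_jdx_k+x_kdx_j)$ - $\Psi(\iota(\xi_j\eta_j\eta_i))=\sqrt2\,x_idx_1$ - $\Psi(\iota(\xi_i\xi_j))=x_k(x_2\partial_{x_2}+x_3\partial_{x_3}+x_4\partial_{x_4})$ - $\Psi(\iota(\xi_j\xi_i\eta_i))=\sqrt2\,x_ix_kdx_1$ - $\Psi(\iota(\xi_i\xi_j\eta_k))=-\sqrt2\,x_k^2dx_1$ The remaining $\xi_I$ with $|I|\le3$ are covered by antisymmetry of the monomials, by $\iota(\xi_i\eta_j\eta_k)=0$ and $\iota(\xi_2\xi_3\xi_4)=0$, and by the identity $\iota(A(\xi_I))=\iota(\xi_I)$ for $|I|=3$. $\Psi$ is extended linearly (and continuously). *)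

(* Defs.v *)
From HB Require Import structures.
From mathcomp Require Import all_boot all_order all_algebra.
From mathcomp Require Import boolp functions finset.
From mathcomp Require Import ring mpoly.

Set Implicit Arguments.
Unset Strict Implicit.
Unset Printing Implicit Defensive.

Import Order.TTheory GRing.Theory Num.Theory.

Local Open Scope ring_scope.

(* A formal power series in n variables is its family of coefficients, indexed
   by the exponents 'X_{1..n} of multinomials. The multiplication is the one
   of mcoeffM. *)

Definition fps (F : fieldType) (n : nat) : Type := 'X_{1..n} -> F^o.

HB.instance Definition _ (F : fieldType) (n : nat) :=
  GRing.Lmodule.copy (fps F n) ('X_{1..n} -> F^o).

Section FpsRing.
Variables (F : fieldType) (n : nat).
Implicit Types f g h : fps F n.

Definition fps_one : fps F n := fun m => (m == 0%MM)%:R.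

Definition fps_mul f g : fps F n := fun m =>
  \sum_(k : 'X_{1..n < (mdeg m).+1, (mdeg m).+1} | m == (k.1 + k.2)%MM)
     f k.1 * g k.2.

Let trunc k f : {mpoly F[n]} :=
  \sum_(a : 'X_{1..n < k}) (f a : F) *: 'X_[a].

Let trunc_coef k f m : (mdeg m < k)%N -> (trunc k f)@_m = f m.
Proof.
move=> mk; rewrite /trunc raddf_sum (bigD1 (BMultinom mk)) //= big1 => [|a ne].
  by rewrite addr0 mcoeffZ mcoeffX eqxx mulr1.
rewrite mcoeffZ mcoeffX; case: eqP => [e|_]; last by rewrite mulr0.
by case/eqP: ne; apply: val_inj.
Qed.

Let mcoeffM_eq (p q p' q' : {mpoly F[n]}) m :
  (forall a, (mdeg a <= mdeg m)%N -> p@_a = p'@_a /\ q@_a = q'@_a) ->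
  (p * q)@_m = (p' * q')@_m.
Proof.
move=> H; rewrite !mcoeffM; apply: eq_bigr => k _.
by rewrite (proj1 (H _ _)) ?(proj2 (H _ _)) // -ltnS bmdeg.
Qed.

Let fps_mulE k f g m : (mdeg m < k)%N ->
  fps_mul f g m = (trunc k f * trunc k g)@_m.
Proof.
move=> mk; rewrite mcoeffM; apply: eq_bigr => a _.
by rewrite !trunc_coef // (leq_trans (bmdeg _)).
Qed.

Let fps_mulC : commutative fps_mul.
Proof.
by move=> f g; apply/funext => m; rewrite !(@fps_mulE (mdeg m).+1) // mulrC.
Qed.

Let fps_mulA : associative fps_mul.
Proof.
move=> f g h; apply/funext => m; rewrite !(@fps_mulE (mdeg m).+1) //.
transitivity ((trunc (mdeg m).+1 f * (trunc (mdeg m).+1 g * trunc (mdeg m).+1 h))@_m).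
  apply: mcoeffM_eq => a am; split=> //.
  by rewrite trunc_coef // (@fps_mulE (mdeg m).+1).
rewrite mulrA; apply: mcoeffM_eq => a am; split=> //.
by rewrite trunc_coef // (@fps_mulE (mdeg m).+1).
Qed.

Let fps_mul1 : left_id fps_one fps_mul.
Proof.
move=> f; apply/funext => m; rewrite (@fps_mulE (mdeg m).+1) //.
rewrite -[RHS](@trunc_coef (mdeg m).+1) // -[in RHS](mul1r (trunc _ f)).
apply: mcoeffM_eq => a am; split=> //.
by rewrite trunc_coef // mcoeff1.
Qed.

Let fps_mulDl : left_distributive fps_mul +%R.
Proof.
move=> f g h; apply/funext => m.
rewrite [RHS]/GRing.add /= /fps_mul -big_split /=.
by apply: eq_bigr => k _; rewrite -mulrDl.
Qed.

Let fps_one_neq0 : fps_one != 0.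
Proof.
apply/eqP => /(congr1 (fun f : fps F n => f 0%MM)).
by rewrite /fps_one eqxx => /eqP; rewrite oner_eq0.
Qed.

HB.instance Definition _ := GRing.Zmodule_isComNzRing.Build (fps F n)
  fps_mulA fps_mulC fps_mul1 fps_mulDl fps_one_neq0.

Let fps_scaleAl (a : F) f g : a *: (f * g) = (a *: f) * g.
Proof.
apply/funext => m; rewrite [RHS]/GRing.mul /= /fps_mul.
rewrite [LHS]/GRing.scale /= /GRing.mul /= /fps_mul.
by rewrite [LHS]mulr_sumr; apply: eq_bigr => k _; rewrite mulrA.
Qed.

HB.instance Definition _ :=
  GRing.Lmodule_isLalgebra.Build F (fps F n) fps_scaleAl.

Definition fps_var (i : 'I_n) : fps F n := fun m => (m == U_(i)%MM)%:R.

Definition fps_deriv (i : 'I_n) f : fps F n := fun m =>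
  f (m + U_(i))%MM *+ (m i).+1.

(* The antiderivative in the i-th variable that vanishes when that variable
   is 0. *)
Definition fps_int (i : 'I_n) f : fps F n := fun m =>
  if m i == 0%N then 0 else f (m - U_(i))%MM / (m i)%:R.

End FpsRing.

(* Componentwise multiplication by a ring element. The scaling *: is kept for
   the ground field. *)
Definition bscale (B : comNzRingType) (I : Type) (p : B) (v : I -> B) : I -> B :=
  fun i => p * v i.
Notation "p ** v" := (bscale p v) (at level 40, left associativity).

(* An element of the exterior algebra over B on generators indexed by 'I_m is
   its family of coordinates: f S is the coefficient of the product of the
   generators in S, taken in increasing order. *)

Definition grass (B : Type) (m : nat) : Type := {set 'I_m} -> B.

HB.instance Definition _ (F : fieldType) (m n : nat) :=
  GRing.Lmodule.copy (grass (fps F n) m) ({set 'I_m} -> fps F n).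

Section Grassmann.
Variables (B : comNzRingType) (m : nat).
Implicit Types (f g : grass B m) (S T U : {set 'I_m}) (I : seq 'I_m).

Definition gmono S : grass B m := fun T => (T == S)%:R.
Definition ggen (a : 'I_m) : grass B m := gmono [set a].

Definition crossings S T : nat :=
  #|[set p : 'I_m * 'I_m | [&& p.1 \in S, p.2 \in T & (p.2 < p.1)%N]]|.

Definition gmul f g : grass B m := fun U =>
  \sum_(S : {set 'I_m} | S \subset U)
     (-1) ^+ crossings S (U :\: S) * f S * g (U :\: S).

Definition gprod I : grass B m :=
  foldr (fun a f => gmul (ggen a) f) (gmono set0) I.

(* Left derivative. *)
Definition gderiv (a : 'I_m) f : grass B m := fun T =>
  if a \in T then 0
  else (-1) ^+ #|[set b in T | (b < a)%N]| * f (a |: T).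

(* f |-> (-1)^p(f) f on homogeneous f. *)
Definition gparity f : grass B m := fun S => (-1) ^+ #|S| * f S.

Fixpoint inversions I : nat :=
  if I is a :: J then (count (fun b : 'I_m => (b < a)%N) J + inversions J)%N
  else 0%N.

Lemma gmul_mono S T : gmul (gmono S) (gmono T) =
  (if [disjoint S & T]
   then ((-1) ^+ crossings S T : B) ** (gmono (S :|: T) : grass B m)
   else fun=> 0).
Proof.
apply/funext => U; rewrite /gmul /gmono /bscale.
have [SU|nSU] := boolP (S \subset U); last first.
  rewrite big1 => [|V VU]; last first.
    case: eqP => [e|_]; last by rewrite mulr0 mul0r.
    by rewrite e (negbTE nSU) in VU.
  case: ifP => // _; case: eqP => [e|_]; last by rewrite mulr0.
  by rewrite e subsetUl in nSU.
rewrite (bigD1 S) //= big1 ?addr0 => [|V /andP[_ /negbTE->]]; last first.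
  by rewrite mulr0 mul0r.
rewrite eqxx mulr1; case: (@eqP _ (U :\: S) T) => [e|ne].
  have dST : [disjoint S & T].
    by rewrite -e -setI_eq0 setIDA setDIl setDv set0I.
  have eU : S :|: T = U by rewrite -e -{1}(setIidPr SU) setID.
  by rewrite dST eU eqxx e.
rewrite mulr0; case: ifP => // d; case: eqP => [e|_]; last by rewrite mulr0.
case: ne; apply/setP => x; rewrite e !inE.
by have [xT|_] := boolP (x \in T); rewrite ?orbT ?orbF ?andNb ?(disjointFl d xT).
Qed.

Lemma gmulZ (p q : B) f g :
  gmul (p ** f : grass B m) (q ** g : grass B m) =
  (p * q) ** gmul f g.
Proof.
apply/funext => U; rewrite /gmul /bscale mulr_sumr; apply: eq_bigr => S _.
by ring.
Qed.

Lemma crossings1 (a : 'I_m) I : uniq I ->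
  crossings [set a] [set x in I] = count (fun b : 'I_m => (b < a)%N) I.
Proof.
move=> uI; rewrite -size_filter -(card_uniqP (filter_uniq _ uI)).
rewrite -(card_imset _ (_ : injective (fun b : 'I_m => (a, b)))); last by move=> ? ? [].
rewrite /crossings; congr (#|pred_of_set _|); apply/setP => -[x y].
rewrite !inE /=; apply/idP/imsetP => [/and3P[/eqP-> yI ya]|[b]].
  by exists y; rewrite // mem_filter ya.
by rewrite mem_filter => /andP[ba bI] [-> ->]; rewrite eqxx bI ba.
Qed.

Lemma gprodE I : uniq I ->
  gprod I = ((-1) ^+ inversions I : B) ** gmono [set x in I].
Proof.
elim: I => [_|a I IH /= /andP[aI uI]].
  have -> : [set x in [::]] = set0 :> {set 'I_m}.
    by apply/setP => x; rewrite !inE.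
  by apply/funext => S; rewrite /= /bscale expr0 mul1r.
rewrite IH // (_ : ggen a = 1 ** gmono [set a] :> grass B m); last first.
  by apply/funext => S; rewrite /bscale mul1r.
rewrite gmulZ gmul_mono disjoints1 inE aI crossings1 // mul1r exprD mulrC.
have -> : [set x in a :: I] = [set a] :|: [set x in I].
  by apply/setP => x; rewrite !inE.
by apply/funext => S; rewrite /bscale -mulrA.
Qed.

Lemma inversions_cat I J :
  inversions (I ++ J) =
  (inversions I + inversions J +
   \sum_(a <- I) count (fun b : 'I_m => (b < a)%N) J)%N.
Proof.
elim: I => [|a I IH] /=; first by rewrite big_nil addn0.
by rewrite count_cat IH big_cons; ring.
Qed.

Lemma gprod_cat I J : uniq (I ++ J) ->
  gmul (gprod I) (gprod J) = gprod (I ++ J).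
Proof.
move=> uIJ; have := uIJ; rewrite cat_uniq => /and3P[uI /hasPn nIJ uJ].
rewrite !gprodE // gmulZ gmul_mono.
have -> : [disjoint [set x in I] & [set x in J]].
  apply/pred0P => x /=; rewrite !inE; apply/negP => /andP[xI /nIJ].
  by rewrite /= xI.
have -> : crossings [set x in I] [set x in J] =
          (\sum_(a <- I) count (fun b : 'I_m => (b < a)%N) J)%N.
  rewrite /crossings -sum1_card (big_uniq _ uI) /=.
  rewrite (eq_bigl (fun p : 'I_m * 'I_m =>
     (p.1 \in I) && ((p.2 \in J) && (p.2 < p.1)%N))); last first.
    by move=> [x y]; rewrite !inE.
  rewrite -(pair_big_dep (fun a => a \in I)
    (fun a b : 'I_m => (b \in J) && (b < a)%N) (fun _ _ => 1%N)) /=.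
  apply: eq_bigr => a _; rewrite -size_filter -(card_uniqP (filter_uniq _ uJ)).
  rewrite -sum1_card; apply: eq_bigl => b.
  by rewrite mem_filter andbC.
have -> : [set x in I ++ J] = [set x in I] :|: [set x in J].
  by apply/setP => x; rewrite !inE mem_cat.
by rewrite inversions_cat !exprD; apply/funext => S; rewrite /bscale mulrA.
Qed.

End Grassmann.

Section K16.
Variable F : numClosedFieldType.

Definition K16 : Type := grass (fps F 1) 6.
HB.instance Definition _ := GRing.Lmodule.on K16.

Implicit Types (f g : K16) (I : seq 'I_6).

Definition t_ : fps F 1 := fps_var F ord0.

(* xi_1, xi_2, xi_3, eta_1, eta_2, eta_3 are the generators 0, ..., 5. As bar
   adds 3 modulo 6, xi 4 = eta 1 and eta 4 = xi 1. *)
Definition bar (a : 'I_6) : 'I_6 := inord ((a + 3) %% 6).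
Definition xi (k : nat) : 'I_6 := inord k.-1.
Definition eta (k : nat) : 'I_6 := bar (xi k).

Lemma barK : involutive bar.
Proof.
move=> a; apply: val_inj; rewrite /= !inordK ?ltn_mod //.
by case: a => [[|[|[|[|[|[|?]]]]]] ?].
Qed.

Lemma xi4 : xi 4 = eta 1.
Proof. by apply: val_inj; rewrite /= !inordK. Qed.

Lemma eta4 : eta 4 = xi 1.
Proof. by apply: val_inj; rewrite /= !inordK. Qed.

Definition Kdt f : K16 := fun S => fps_deriv ord0 (f S).

Definition Keuler f : K16 :=
  \sum_(a < 6) (gmul (ggen _ a) (gderiv a f) : K16).

Definition Kbracket f g : K16 :=
  (gmul (f *+ 2 - Keuler f) (Kdt g) : K16)
  - gmul (Kdt f) (g *+ 2 - Keuler g)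
  + \sum_(i <- [:: 1; 2; 3]%N)
      ((gmul (gderiv (xi i) (gparity f)) (gderiv (eta i) g) : K16)
       + gmul (gderiv (eta i) (gparity f)) (gderiv (xi i) g)).

Definition xi_top : seq 'I_6 :=
  [:: xi 2; xi 3; xi 4; eta 2; eta 3; eta 4].

Definition sharp I : K16 :=
  let J := [seq a <- enum 'I_6 | a \notin map bar I] in
  ((-1) ^+ (inversions (map bar I ++ J) + inversions xi_top)) ** gprod _ J.

Lemma sharpP I : uniq I ->
  gmul (gprod _ (map bar I)) (sharp I) = gprod _ xi_top.
Proof.
move=> uI; rewrite /sharp; set J := [seq _ <- _ | _].
have uIJ : uniq (map bar I ++ J).
  rewrite cat_uniq map_inj_uniq ?uI; last exact: inv_inj barK.
  rewrite filter_uniq ?enum_uniq // andbT; apply/hasPn => a.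
  by rewrite mem_filter => /andP[].
have utop : uniq xi_top.
  by rewrite -(map_inj_uniq val_inj) /= !inordK.
have fullE (L : seq 'I_6) : uniq L -> size L = 6 -> [set x in L] = setT.
  move=> uL sL; apply/eqP; rewrite eqEcard subsetT cardsT card_ord.
  by rewrite cardsE (card_uniqP uL) sL.
have sIJ : [set x in map bar I ++ J] = setT.
  apply/setP => a; rewrite !inE mem_cat mem_filter mem_enum /= andbT.
  by rewrite orbN.
have -> : gprod _ (map bar I) = 1 ** gprod _ (map bar I) :> K16.
  by apply/funext => S; rewrite /bscale mul1r.
rewrite gmulZ gprod_cat // !gprodE // sIJ fullE // mul1r.
apply/funext => S; rewrite /bscale mulrA -exprD addnAC addnn exprD.
by rewrite -[X in X * _ * _]signr_odd odd_double mul1r.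
Qed.

(* (d/dt)^(3 - k), where negative powers are iterated integrals from 0. *)
Definition dt_pow3B (k : nat) (p : fps F 1) : fps F 1 :=
  iter (k - 3) (@fps_int _ _ ord0) (iter (3 - k) (@fps_deriv _ _ ord0) p).

(* Monomials are taken with increasing indices. Reordering I multiplies xi_I
   and xi_I^# by the same sign. *)
Definition Aop f : K16 :=
  \sum_(S : {set 'I_6})
     (((-1) ^+ ((#|S| * (#|S| + 1)) %/ 2) * dt_pow3B #|S| (f S))
        ** sharp (enum S) : K16).

Definition iota16 f : K16 := f + Aop f.

Lemma iota16_is_linear : linear iota16.
Proof.
have dL : linear (@fps_deriv F 1 ord0).
  move=> a p q; apply/funext => m; rewrite /fps_deriv.
  by rewrite [LHS]mulrnDl scalerMnr.
have iL : linear (@fps_int F 1 ord0).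
  move=> a p q; apply/funext => m.
  rewrite [RHS](_ : _ = a *: fps_int ord0 p m + fps_int ord0 q m) // /fps_int.
  case: ifP => _; first by rewrite scaler0 addr0.
  by rewrite [LHS]mulrDl; congr (_ + _); rewrite -[LHS]mulrA.
have itL (h : fps F 1 -> fps F 1) k : linear h -> linear (iter k h).
  by move=> hL a p q; elim: k => //= k ->; rewrite hL.
move=> a f g; rewrite /iota16 scalerDr addrACA; congr (_ + _).
rewrite /Aop scaler_sumr -big_split; apply: eq_bigr => S _.
rewrite /dt_pow3B [(a *: f + g) S](_ : _ = a *: f S + g S) // !itL //.
apply/funext => T; rewrite /bscale mulrDr mulrDl; congr (_ + _).
have Z (c d s : fps F 1) : c * (a *: d) * s = a *: (c * d * s).
  by rewrite (mulrC c) -!scalerAl (mulrC d).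
exact: Z.
Qed.

HB.instance Definition _ := GRing.isLinear.Build F K16 K16 *:%R iota16
  iota16_is_linear.

Definition inE16 : {pred K16} := fun f => `[< exists g, iota16 g = f >].

Lemma inE16_submod : submod_closed inE16.
Proof.
split=> [|a _ _ /asboolP[f <-] /asboolP[g <-]]; apply/asboolP.
  by exists 0; rewrite linear0.
by exists (a *: f + g); rewrite linearP.
Qed.

HB.instance Definition _ := GRing.isSubmodClosed.Build F K16 inE16 inE16_submod.

Record E16 := MkE16 { e16val :> K16; e16P : e16val \in inE16 }.
HB.instance Definition _ := [isSub for e16val].
HB.instance Definition _ := [Choice of E16 by <:].
HB.instance Definition _ := [SubChoice_isSubLmodule of E16 by <:].

Lemma iota16_in f : iota16 f \in inE16.
Proof. by apply/asboolP; exists f. Qed.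

Definition iota f : E16 := MkE16 (iota16_in f).

End K16.

Section E44.
Variable F : numClosedFieldType.

Definition W4 : Type := 'I_4 -> fps F 4.
Definition Omega1 : Type := 'I_4 -> fps F 4.
HB.instance Definition _ := GRing.Lmodule.copy W4 ('I_4 -> fps F 4).
HB.instance Definition _ := GRing.Lmodule.copy Omega1 ('I_4 -> fps F 4).

(* A pair is the sum of an even and an odd element. *)
Definition E44 : Type := (W4 * Omega1)%type.
HB.instance Definition _ := GRing.Lmodule.copy E44 (W4 * Omega1)%type.

Definition form : Type := grass (fps F 4) 4.
HB.instance Definition _ := GRing.Lmodule.on form.

Implicit Types (X Y : W4) (w : Omega1) (th : form).

Definition vf_bracket X Y : W4 := fun i =>
  \sum_(j < 4) (X j * fps_deriv j (Y i) - Y j * fps_deriv j (X i)).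

Definition divergence X : fps F 4 := \sum_(j < 4) fps_deriv j (X j).

Definition lie_derivative X w : Omega1 := fun i =>
  \sum_(j < 4) (X j * fps_deriv j (w i) + w j * fps_deriv i (X j)).

Definition W4_act X w : Omega1 :=
  lie_derivative X w - 2^-1 *: (divergence X ** w : Omega1).

Definition form_of_Omega1 w : form :=
  \sum_(i < 4) (w i ** ggen _ i : form).

Definition ext_d th : form :=
  \sum_(i < 4) (gmul (ggen _ i) (fun S => fps_deriv i (th S)) : form).

Definition contract X th : form :=
  \sum_(i < 4) (X i ** gderiv i th : form).

Definition volume : form := gmono _ [set: 'I_4].

(* The vector field X such that contract X volume is the given 3-form. *)
Definition vf_of_form3 th : W4 := fun i => (-1) ^+ i * th [set~ i].

Lemma contract_vf_of_form3 th :
  (forall S : {set 'I_4}, #|S| != 3 -> th S = 0) ->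
  contract (vf_of_form3 th) volume = th.
Proof.
move=> th3; apply/funext => S.
have contrE : contract (vf_of_form3 th) volume S =
    \sum_(i < 4) vf_of_form3 th i * gderiv i volume S.
  by rewrite /contract; elim/big_rec2: _ => // i _ y _ <-.
have dS (i : 'I_4) : gderiv i volume S = if S == [set~ i] then (-1) ^+ i else 0.
  rewrite /gderiv /volume /gmono; case: (S =P [set~ i]) => [->|ne].
    rewrite !inE eqxx /= setUCr eqxx mulr1; congr (_ ^+ _).
    rewrite -sum1_card (eq_bigl (fun b : 'I_4 => (b < i)%N)).
      by rewrite (big_ord_narrow (ltnW (ltn_ord i))) sum_nat_const card_ord muln1.
    move=> b; rewrite !inE; case: eqP => //= ->; exact: esym (ltnn i).
  case: ifP => // /negbT iS; case: eqP => [e|_]; last by rewrite mulr0.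
  case: ne; apply/setP => b; move/setP/(_ b): e; rewrite !inE.
  by case: (b =P i) => [->|_] /=; first by rewrite (negbTE iS).
rewrite contrE; have [S3|nS3] := eqVneq #|S| 3; last first.
  rewrite th3 // big1 // => i _; rewrite dS; case: eqP => [e|_]; last exact: mulr0.
  by case/eqP: nS3; rewrite e cardsC1 card_ord.
have /eqP/cards1P[i Ci] : #|~: S| = 1%N.
  by have := cardsC S; rewrite S3 card_ord => /eqP; rewrite (eqn_add2l 3 _ 1) => /eqP.
have {Ci} Si : S = [set~ i] by rewrite -Ci setCK.
rewrite (bigD1 i) //= big1 ?addr0 => [|j ji]; last first.
  rewrite dS Si; case: eqP => [e|_]; last by rewrite mulr0.
  by move/setP/(_ j): e; rewrite !inE eqxx ji.
rewrite dS Si eqxx /vf_of_form3 mulrAC -expr2 sqrr_sign mul1r //.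
Qed.

Definition form_bracket w1 w2 : W4 :=
  vf_of_form3 ((gmul (ext_d (form_of_Omega1 w1)) (form_of_Omega1 w2) : form)
               + gmul (form_of_Omega1 w1) (ext_d (form_of_Omega1 w2))).

(* [w, X] = - [X, w] for X even and w odd. *)
Definition Ebracket (a b : E44) : E44 :=
  (vf_bracket a.1 b.1 + form_bracket a.2 b.2,
   W4_act a.1 b.2 - W4_act b.1 a.2).

Definition Escale (p : fps F 4) (a : E44) : E44 :=
  (p ** a.1 : W4, p ** a.2 : Omega1).

(* The index k of x_k ranges over 1, ..., 4. *)
Definition x_ (k : nat) : fps F 4 := fps_var F (inord k.-1).
Definition ddx (k : nat) : E44 := (fun i => (i == inord k.-1)%:R, 0).
Definition dx (k : nat) : E44 := (0, fun i => (i == inord k.-1)%:R).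

End E44.

Section Psi.
Variable F : numClosedFieldType.
Implicit Types Psi : {linear E16 F -> E44 F}.

(* Continuity at 0, hence everywhere by linearity, for the t-adic topology on
   E(1,6) induced from K(1,6) and the (x_1, ..., x_4)-adic one on E(4,4). *)
Definition adic_continuous Psi : Prop :=
  forall N : nat, exists M : nat, forall f : E16 F,
    (forall S m, (mdeg m < M)%N -> (f : K16 F) S m = 0) ->
    forall i m, (mdeg m < N)%N -> (Psi f).1 i m = 0 /\ (Psi f).2 i m = 0.

Definition cyclic234 (i j k : nat) : bool :=
  (i, j, k) \in [:: (2, 3, 4); (3, 4, 2); (4, 2, 3)]%N.

Definition prescribed_n0 Psi : Prop :=
  let r : F := sqrtC 2 in
  let P (I : seq 'I_6) := Psi (iota (gprod _ I)) in
  P [::] = ddx F 1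
  /\ (forall i j : nat, i \in [:: 2; 3; 4]%N -> j \in [:: 2; 3; 4]%N -> i != j ->
        P [:: xi i; eta j] = Escale (x_ F j) (ddx F i))
  /\ forall i j k : nat, cyclic234 i j k ->
       P [:: eta i; eta j] = ddx F k
    /\ P [:: eta i] = (r / 2) *: dx F i
    /\ P [:: eta i; eta j; eta k] = - r *: dx F 1
    /\ P [:: xi i; eta i] =
         - Escale (x_ F j) (ddx F j) - Escale (x_ F k) (ddx F k)
    /\ P [:: xi i] =
         (r / 2) *: (- Escale (x_ F j) (dx F k) + Escale (x_ F k) (dx F j))
    /\ P [:: xi j; eta j; eta i] = r *: Escale (x_ F i) (dx F 1)
    /\ P [:: xi i; xi j] =
         Escale (x_ F k) (Escale (x_ F 2) (ddx F 2)
                          + Escale (x_ F 3) (ddx F 3)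
                          + Escale (x_ F 4) (ddx F 4))
    /\ P [:: xi j; xi i; eta i] = r *: Escale (x_ F i * x_ F k) (dx F 1)
    /\ P [:: xi i; xi j; eta k] = - r *: Escale (x_ F k ^+ 2) (dx F 1).

Definition prescribed_tn Psi : Prop :=
  forall (n : nat) (I : seq 'I_6), (1 <= n)%N -> uniq I -> (size I <= 3)%N ->
    Psi (iota (t_ F ^+ n ** gprod _ I)) =
    2 ^+ n *: Escale (x_ F 1 ^+ n) (Psi (iota (gprod _ I))).

Definition is_Psi Psi : Prop :=
  [/\ adic_continuous Psi, prescribed_n0 Psi & prescribed_tn Psi].

Definition K_even (f : K16 F) : Prop :=
  forall S : {set 'I_6}, odd #|S| -> f S = 0.
Definition K_odd (f : K16 F) : Prop :=
  forall S : {set 'I_6}, ~~ odd #|S| -> f S = 0.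

Definition preserves_parity Psi : Prop :=
  forall f : E16 F,
    (K_even f -> (Psi f).2 = 0) /\ (K_odd f -> (Psi f).1 = 0).

(* The bracket of E(1,6) is that of K(1,6): the value h of [f, g] in E(1,6)
   is required to exist. *)
Definition preserves_bracket Psi : Prop :=
  forall f g : E16 F, exists h : E16 F,
    (h : K16 F) = Kbracket f g /\ Psi h = Ebracket (Psi f) (Psi g).

Definition superalgebra_embedding Psi : Prop :=
  [/\ preserves_parity Psi, preserves_bracket Psi & injective Psi].

End Psi.

(* Main.v *)
From HB Require Import structures.
From mathcomp Require Import all_boot all_order all_algebra.
From mathcomp Require Import boolp functions finset.
From mathcomp Require Import reals complex.
From mathcomp Require Import ring mpoly.
Require Import Defs.

(* An element f of E(1,6) is determined by its coordinates f_S with |S| <= 3,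
   and E(1,6) is cut out of K(1,6) by the equations
   f_S = (+/-) (d/dt)^(|S|-3) f_{S*} for |S| >= 3, where xi_{S*} is xi_S^# up to
   sign; hence 32 coordinates f_I are free. On these Psi is the sum of the
   f_I(2 x_1) V_I, where V_I is a polynomial in x_2, x_3, x_4, so that both
   sides of Psi [f, g] = [Psi f, Psi g], and the equations of E(1,6) for [f, g],
   are polynomials with integer coefficients in the x_k and the derivatives of
   the free coordinates of f and g. After rescaling the odd part by sqrt 2 / 2
   they are compared by computation on formal polynomials. Psi is injective
   because each f_I is a combination of the coefficients in x_2, x_3, x_4 of the
   coordinates of Psi f. It is unique because f is the sum of the iota(p xi_I)
   for the 32 words I, and p is a t-adic limit of polynomials. *)

Set Implicit Arguments.
Unset Strict Implicit.
Unset Printing Implicit Defensive.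

Import Order.TTheory GRing.Theory Num.Theory.

Local Open Scope ring_scope.

(** Formal computation is legitimate because [inE16P] replaces membership in the image of iota by
    equations under which every coordinate is zero, a free coordinate or a derivative of one. The
    Leibniz and chain rules then suffice, and the free coordinates can be treated as independent
    symbols. Only derivatives occur in these equations: the integrals in A are removed once and for
    all by [fps_intK]. The number 32 is 22 + 10. All words with |I| <= 2 are free. Of the 20 sets of
    size 3, twelve form six dual pairs, each with one free coordinate; eight are their own dual,
    four with sign +1 (free) and four with sign -1 (zero, whence for instance iota(xi_2 xi_3 xi_4) =
    0). The scale t = 2 x_1 is forced: iota(1) = 1 acts by the bracket as 2 d/dt, while Psi(iota(1))
    = d/dx_1. *)

(** * Power series: truncation, derivatives, monomials *)

Section FpsTheory.
Variables (F : fieldType) (n : nat).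
Implicit Types (f g : fps F n) (m e : 'X_{1..n}).

Definition fps_trunc k f : {mpoly F[n]} :=
  \sum_(a : 'X_{1..n < k}) (f a : F) *: 'X_[a].

Lemma fps_trunc_coef k f m : (mdeg m < k)%N -> (fps_trunc k f)@_m = f m.
Proof.
move=> mk; rewrite /fps_trunc raddf_sum (bigD1 (BMultinom mk)) //= big1 => [|a ne].
  by rewrite addr0 mcoeffZ mcoeffX eqxx mulr1.
rewrite mcoeffZ mcoeffX; case: eqP => [ea|_]; last by rewrite mulr0.
by case/eqP: ne; apply: val_inj.
Qed.

Lemma fps_mul_coef f g m : (f * g) m =
  \sum_(k : 'X_{1..n < (mdeg m).+1, (mdeg m).+1} | m == (k.1 + k.2)%MM)
     f k.1 * g k.2.
Proof. by []. Qed.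

(** A coefficient of a product only involves coefficients of at most its own degree. Identities
    between series can therefore be checked on truncations, where the theory of [{mpoly F[n]}]
    applies. *)
Lemma fps_mul_mpoly f g (p q : {mpoly F[n]}) m :
  (forall a, (mdeg a <= mdeg m)%N -> f a = p@_a /\ g a = q@_a) ->
  (f * g) m = (p * q)@_m.
Proof.
move=> H; rewrite mcoeffM fps_mul_coef; apply: eq_bigr => k _.
by rewrite (proj1 (H _ _)) ?(proj2 (H _ _)) // -ltnS bmdeg.
Qed.

Lemma fps_derivM i f g :
  fps_deriv i (f * g) = fps_deriv i f * g + f * fps_deriv i g.
Proof.
apply/funext => m; rewrite /fps_deriv.
(* The derivative at [m] reads coefficients of degree [mdeg m + 1], which the truncation must
   keep. *)
set k := (mdeg m).+2; pose p := fps_trunc k f; pose q := fps_trunc k g.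
have dU a : mdeg (a + U_(i)) = (mdeg a).+1 by rewrite mdegD mdeg1 addn1.
have pE a : (mdeg a < k)%N -> f a = p@_a by move=> ak; rewrite fps_trunc_coef.
have qE a : (mdeg a < k)%N -> g a = q@_a by move=> ak; rewrite fps_trunc_coef.
rewrite (@fps_mul_mpoly _ _ p q) => [|a]; last first.
  by rewrite dU => am; rewrite pE ?qE.
rewrite -mcoeff_deriv mderivM mcoeffD; congr (_ + _); symmetry; apply: fps_mul_mpoly => a am.
- by rewrite mcoeff_deriv -pE ?dU // qE // ltnS leqW.
- by rewrite mcoeff_deriv -qE ?dU // pE // ltnS leqW.
Qed.

Lemma fps_deriv_is_linear i : linear (@fps_deriv F n i).
Proof.
move=> a f g; apply/funext => m; rewrite /fps_deriv.
by rewrite [LHS]mulrnDl scalerMnr.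
Qed.

HB.instance Definition _ i := GRing.isLinear.Build F (fps F n) (fps F n) *:%R
  (@fps_deriv F n i) (fps_deriv_is_linear i).

Definition fps_X e : fps F n := fun m => (m == e)%:R.

Lemma fps_mulX f e m :
  (f * fps_X e) m = if (e <= m)%MM then f (m - e)%MM else 0.
Proof.
rewrite fps_mul_coef; case: ifP => [em|nem]; last first.
  rewrite big1 // => k /eqP mE; rewrite /fps_X; case: eqP => [ke|_]; last by rewrite mulr0.
  by rewrite mE -ke lem_addl in nem.
have dm : mdeg m = (mdeg (m - e)%MM + mdeg e)%N by rewrite -mdegD submK.
have lt1 : (mdeg (m - e)%MM < (mdeg m).+1)%N by rewrite ltnS dm leq_addr.
have lt2 : (mdeg e < (mdeg m).+1)%N by rewrite ltnS dm leq_addl.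
rewrite (bigD1 (BMultinom lt1, BMultinom lt2)) /= ?submK // big1 => [|k /andP[/eqP mE ne]].
  by rewrite /fps_X eqxx mulr1 addr0.
rewrite /fps_X; case: eqP => [ke|_]; last by rewrite mulr0.
case/eqP: ne; case: k ke mE => k1 k2 /= ke mE.
congr (_, _); apply: val_inj => //=.
by rewrite [in RHS]mE -ke addmK.
Qed.

Lemma fps_XM e e' : fps_X e * fps_X e' = fps_X (e + e')%MM.
Proof.
apply/funext => m; rewrite fps_mulX /fps_X; case: ifP => [em|nem].
  by congr (_%:R); rewrite -(inj_eq (@addIm _ e')) submK.
by case: eqP => // mE; rewrite mE lem_addl in nem.
Qed.

Lemma fps_deriv_var i j : fps_deriv i (fps_var F j) = (i == j)%:R :> fps F n.
Proof.
apply/funext => m; rewrite /fps_deriv /fps_var.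
have [->|ij] := eqVneq i j.
  rewrite -{2}(add0m U_(j)%MM) (inj_eq (@addIm _ U_(j)%MM)).
  rewrite [RHS](_ : _ = (m == 0%MM)%:R) //.
  by case: eqP => [->|_]; rewrite ?mnm0E ?mul0rn.
case: eqP => [/(congr1 (fun a : 'X_{1..n} => a i))|_]; last by rewrite mul0rn.
by rewrite mnmDE !mnm1E eqxx eq_sym (negbTE ij) addn1.
Qed.

End FpsTheory.

(** Characteristic 0 allows division by [(m i).+1]. The opposite composition would lose the constant
    of integration; this is why the equations of E(1,6) are oriented towards differentiation, from
    |S| >= 3. *)
Lemma fps_intK (F : numFieldType) (n : nat) i :
  cancel (@fps_int F n i) (fps_deriv i).
Proof.
move=> f; apply/funext => m; rewrite /fps_deriv /fps_int mnmDE mnm1E eqxx addn1 /=.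
rewrite addmK [X in X *+ _](_ : _ = (f m : F) / (m i).+1%:R) //.
by rewrite [LHS](_ : _ = ((f m : F) / (m i).+1%:R) *+ (m i).+1) // -mulr_natr divfK ?pnatr_eq0.
Qed.

(** * Substitution of a multiple of the first variable *)

Section Substitution.
Variables (F : fieldType) (n : nat) (c : F).
Implicit Types (p q : fps F 1) (m e : 'X_{1..n.+1}).

(* The substitution t |-> c x_1. *)
Definition fps_subst p : fps F n.+1 := fun m =>
  if m == (U_(ord0) *+ m ord0)%MM then c ^+ m ord0 * p (U_(ord0) *+ m ord0)%MM
  else 0.

Lemma mnm1_ord1 (a : 'X_{1..1}) : a = (U_(ord0) *+ a ord0)%MM.
Proof. by apply/mnmP => i; rewrite mulmnE mnm1E !ord1 mul1n. Qed.

(** On polynomials, [fps_subst] is a composition; multiplicativity of the former is inherited from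
    [comp_mpoly] through truncations. *)
Lemma comp_mpoly_coef (q : {mpoly F[1]}) m :
  (q \mPo [tuple c *: 'X_ord0 : {mpoly F[n.+1]}])@_m =
  if m == (U_(ord0) *+ m ord0)%MM then c ^+ m ord0 * q@_(U_(ord0) *+ m ord0)%MM
  else 0.
Proof.
rewrite comp_mpolyE raddf_sum /=.
have E (a : 'X_{1..1}) :
    (q@_a *: \prod_(i < 1)
       tnth [tuple (c *: 'X_ord0 : {mpoly F[n.+1]})] i ^+ a i)@_m
   = if m == (U_(ord0) *+ a ord0)%MM then c ^+ a ord0 * q@_a else 0.
  rewrite big_ord1 tnth0 exprZn mpolyXn mcoeffZ mcoeffZ mcoeffX eq_sym.
  by case: ifP => _; rewrite ?mulr1 ?mulr0 // mulrC.
under eq_bigr do rewrite E.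
case: ifP => [/eqP mE|nm]; last first.
  rewrite big1_seq // => a _; case: eqP => // mE; case/eqP: nm.
  by rewrite {2}mE mulmnE mnm1E eqxx mul1n.
set a := (U_(ord0) *+ m ord0)%MM : 'X_{1..1}.
have aE : a ord0 = m ord0 by rewrite mulmnE mnm1E eqxx mul1n.
have ne (b : 'X_{1..1}) : b != a -> (m == (U_(ord0) *+ b ord0)%MM) = false.
  apply: contraNF => /eqP mb; apply/eqP; rewrite (mnm1_ord1 b) /a mb.
  by rewrite mulmnE mnm1E eqxx mul1n.
have [aq|aq] := boolP (a \in msupp q).
  rewrite (bigD1_seq a) //= aE -mE eqxx big1 ?addr0 // => b /ne ->.
  by [].
rewrite big1_seq => [|b /= bq]; last first.
  by rewrite ne //; apply: contraNneq aq => <-.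
by rewrite (memN_msupp_eq0 aq) mulr0.
Qed.

Lemma fps_subst_is_linear : linear fps_subst.
Proof.
move=> a p q; apply/funext => m; rewrite /fps_subst.
rewrite [RHS](_ : _ = a * fps_subst p m + fps_subst q m) // /fps_subst.
case: ifP => _; last by rewrite mulr0 addr0.
rewrite [in LHS](_ : (a *: p + q) _ =
  a * p (U_(ord0) *+ m ord0)%MM + q (U_(ord0) *+ m ord0)%MM) //.
by ring.
Qed.

HB.instance Definition _ := GRing.isLinear.Build F (fps F 1) (fps F n.+1) *:%R
  fps_subst fps_subst_is_linear.

Lemma fps_subst_is_monoid_morphism : monoid_morphism fps_subst.
Proof.
split=> [|p q]; apply/funext => m.
  rewrite /fps_subst [RHS](_ : _ = (m == 0%MM)%:R) //.
  rewrite [(1 : fps F 1) _](_ : _ = ((U_(ord0) *+ m ord0)%MM == 0%MM :> 'X_{1..1})%:R) //.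
  have -> : ((U_(ord0) *+ m ord0)%MM == 0%MM :> 'X_{1..1}) = (m ord0 == 0%N).
    apply/eqP/eqP => [/(congr1 (fun a : 'X_{1..1} => a ord0))|->]; last by rewrite mulm0n.
    by rewrite mulmnE mnm1E eqxx mul1n mnm0E.
  case: ifP => [/eqP mE|]; last by case: (m =P 0%MM) => // ->; rewrite mnm0E mulm0n eqxx.
  case: (m ord0 =P 0%N) mE => [->|m0 mE].
    by rewrite mulm0n => ->; rewrite eqxx expr0 mulr1.
  by rewrite mulr0; case: eqP => // m1; rewrite m1 mnm0E in m0.
set k := (mdeg m).+1; pose P := fps_trunc k p; pose Q := fps_trunc k q.
have [PE QE] : (forall a, (mdeg a < k)%N -> p a = P@_a)
    /\ (forall a, (mdeg a < k)%N -> q a = Q@_a).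
  by split=> a ak; rewrite fps_trunc_coef.
have dm (a : 'X_{1..n.+1}) : mdeg (U_(ord0) *+ a ord0 : 'X_{1..1})%MM = a ord0.
  by rewrite mdegMn mdeg1 mul1n.
have ma (a : 'X_{1..n.+1}) : (a ord0 <= mdeg a)%N.
  by rewrite mdegE (bigD1 ord0) //= leq_addr.
pose comp r := (r \mPo [tuple (c *: 'X_ord0 : {mpoly F[n.+1]})]) : {mpoly F[n.+1]}.
transitivity ((comp P * comp Q)@_m).
  rewrite -rmorphM comp_mpoly_coef /fps_subst; case: ifP => // _.
  congr (_ * _); apply: fps_mul_mpoly => a; rewrite dm => am.
  have ak : (mdeg a < k)%N by rewrite ltnS (leq_trans am).
  by rewrite PE ?QE.
symmetry; apply: fps_mul_mpoly => a am; rewrite !comp_mpoly_coef /fps_subst.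
by case: ifP => // _; rewrite PE ?QE // dm ltnS (leq_trans (ma a)).
Qed.

HB.instance Definition _ := GRing.isMonoidMorphism.Build (fps F 1) (fps F n.+1)
  fps_subst fps_subst_is_monoid_morphism.

Lemma fps_subst_var : fps_subst (fps_var F ord0) = c *: fps_var F ord0.
Proof.
apply/funext => m; rewrite /fps_subst [RHS](_ : _ = c * fps_var F ord0 m) // /fps_var.
have -> : (U_(ord0) *+ m ord0 == U_(ord0) :> 'X_{1..1})%MM = (m ord0 == 1%N).
  apply/eqP/eqP => [/(congr1 (fun a : 'X_{1..1} => a ord0))|->]; last by rewrite mulm1n.
  by rewrite mulmnE !mnm1E eqxx mul1n.
have -> : (m == U_(ord0)%MM) = (m == (U_(ord0) *+ m ord0)%MM) && (m ord0 == 1%N).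
  have [->|m1] := eqVneq (m ord0) 1%N; first by rewrite mulm1n andbT.
  by rewrite andbF; apply: contraNF m1 => /eqP ->; rewrite mnm1E eqxx.
case: ifP => _; last by rewrite mulr0.
by case: eqP => [->|_]; rewrite ?mulr0.
Qed.

Lemma fps_deriv_subst0 p :
  fps_deriv ord0 (fps_subst p) = c *: fps_subst (fps_deriv ord0 p).
Proof.
apply/funext => m; rewrite /fps_deriv /fps_subst.
rewrite [RHS](_ : _ = c * fps_subst (fps_deriv ord0 p) m) // /fps_subst.
rewrite mnmDE mnm1E eqxx addn1 mulmSr (inj_eq (@addIm _ _)).
case: ifP => _; last by rewrite mul0rn mulr0.
rewrite /fps_deriv mulmSr mulmnE mnm1E eqxx mul1n exprS.
rewrite [LHS](_ : _ = (c * c ^+ m ord0 * p (U_(ord0) *+ m ord0 + U_(ord0))%MM) *+ (m ord0).+1) //.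
by rewrite -mulrnAr mulrA.
Qed.

Lemma fps_deriv_subst (i : 'I_n.+1) p : i != ord0 -> fps_deriv i (fps_subst p) = 0.
Proof.
move=> i0; apply/funext => m; rewrite /fps_deriv /fps_subst.
case: eqP => [/(congr1 (fun a : 'X_{1..n.+1} => a i))|_]; last by rewrite mul0rn.
by rewrite mnmDE mnm1E eqxx mulmnE mnm1E eq_sym (negbTE i0) mul0n addn1.
Qed.

(** Since [e] and [e'] do not involve the first variable, its powers come from [p] alone. This
    separates the series f_I in the proof of injectivity. *)
Lemma fps_substMX_coef p e e' k : e ord0 = 0%N -> e' ord0 = 0%N ->
  (fps_subst p * fps_X F e) (e' + U_(ord0) *+ k)%MM =
  if e == e' then c ^+ k * p (U_(ord0) *+ k)%MM else 0.
Proof.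
move=> e0 e0'; rewrite fps_mulX.
have mk : (e' + U_(ord0) *+ k)%MM ord0 = k by rewrite mnmDE mulmnE mnm1E eqxx e0' mul1n.
case: eqP => [<-|ne].
  rewrite lem_addr // addmC addmK /fps_subst.
  by rewrite mulmnE mnm1E eqxx mul1n eqxx.
case: ifP => // le; rewrite /fps_subst mnmBE mk e0 subn0.
case: eqP => // E; case: ne; apply/mnmP => i.
have := congr1 (fun a : 'X_{1..n.+1} => a i) (submK le); rewrite E !mnmDE.
by move/eqP; rewrite addnC eqn_add2r => /eqP.
Qed.

End Substitution.

(* A formal polynomial is a list of monomials, each an integer coefficient with
   a list of variables. *)
Section FormalPolynomials.
Variable T : eqType.

Definition fpoly : Type := seq (int * seq T).
Implicit Types (p q : fpoly) (u : int * seq T) (s : seq T).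

Definition pconst (z : int) : fpoly := [:: (z, [::])].
Definition pvar (x : T) : fpoly := [:: (1, [:: x])].
(** The integer operations are named concretely, not through the ring structure, for evaluation by
    [vm_compute]. *)
Definition pscale (z : int) p : fpoly := [seq (intRing.mulz z u.1, u.2) | u <- p].
Definition pmul p q : fpoly :=
  flatten [seq [seq (intRing.mulz u.1 v.1, u.2 ++ v.2) | v <- q] | u <- p].
Definition psum (I : Type) (r : seq I) (f : I -> fpoly) : fpoly :=
  flatten [seq f i | i <- r].

Fixpoint pderiv_mono (d : T -> fpoly) s : fpoly :=
  if s is x :: s' then
    pmul (d x) [:: (1, s')] ++ pmul (pvar x) (pderiv_mono d s')
  else [::].
Definition pderiv d p : fpoly :=
  psum p (fun u => pscale u.1 (pderiv_mono d u.2)).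

Fixpoint pinsert u p : fpoly :=
  if p is v :: p' then
    if u.2 == v.2 then (intZmod.addz u.1 v.1, v.2) :: p' else v :: pinsert u p'
  else [:: u].
(** Equal monomials are recognized after sorting by [rank]. A [rank] that is not injective may leave
    some of them uncollected; the test can then fail, but never succeed wrongly, as sorting only
    permutes factors. *)
Definition pnull (rank : T -> nat) p : bool :=
  all (fun u : int * seq T => u.1 == 0)
    (foldr pinsert [::]
       [seq (u.1, sort (fun x y => rank x <= rank y)%N u.2) | u <- p]).

Section Evaluation.
Variables (B : comNzRingType) (env : T -> B).

Definition peval p : B := \sum_(u <- p) u.1%:~R * \prod_(x <- u.2) env x.

Lemma peval_nil : peval [::] = 0. Proof. exact: big_nil. Qed.

Lemma peval_const z : peval (pconst z) = z%:~R.
Proof. by rewrite /peval big_seq1 big_nil mulr1. Qed.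

Lemma peval_var x : peval (pvar x) = env x.
Proof. by rewrite /peval !big_seq1 mul1r. Qed.

Lemma peval_cat p q : peval (p ++ q) = peval p + peval q.
Proof. exact: big_cat. Qed.

Lemma peval_sum (I : Type) (r : seq I) f :
  peval (psum r f) = \sum_(i <- r) peval (f i).
Proof.
elim: r => [|i r IH]; first by rewrite big_nil peval_nil.
by rewrite big_cons -IH -peval_cat.
Qed.

Lemma peval_scale z p : peval (pscale z p) = z%:~R * peval p.
Proof.
rewrite /peval big_map mulr_sumr; apply: eq_bigr => u _ /=.
by rewrite -[intRing.mulz _ _]/(z * u.1) intrM mulrA.
Qed.

Lemma peval_mul p q : peval (pmul p q) = peval p * peval q.
Proof.
rewrite [pmul p q]/(psum p _) peval_sum /peval mulr_suml; apply: eq_bigr => u _.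
rewrite big_map mulr_sumr; apply: eq_bigr => v _ /=.
by rewrite -[intRing.mulz _ _]/(u.1 * v.1) intrM big_cat mulrACA.
Qed.

(** Both sides are additive, obey the Leibniz rule and agree on the variables. *)
Lemma peval_deriv (D : {additive B -> B}) d p :
  (forall a b, D (a * b) = D a * b + a * D b) ->
  (forall x, D (env x) = peval (d x)) -> peval (pderiv d p) = D (peval p).
Proof.
move=> DM Denv.
have D1 : D 1 = 0.
  by apply: (addrI (D 1)); rewrite addr0 -[RHS](congr1 D (mulr1 1)) DM mulr1 mul1r.
rewrite peval_sum raddf_sum; apply: eq_bigr => u _.
rewrite peval_scale mulrzl [RHS](congr1 D (mulrzl _ _)) raddfMz; congr (_ *~ _).
elim: u.2 => [|x s IH] /=; first by rewrite big_nil D1 peval_nil.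
rewrite peval_cat !peval_mul peval_var IH big_cons DM Denv; congr (_ * _ + _).
by rewrite /peval big_seq1 mul1r.
Qed.

Lemma peval_insert u p :
  peval (pinsert u p) = u.1%:~R * \prod_(x <- u.2) env x + peval p.
Proof.
elim: p => [|v p IH] /=; first by rewrite /peval big_seq1 big_nil addr0.
case: eqP => [uv|_]; last by rewrite /peval !big_cons -!/(peval _) IH addrCA.
rewrite /peval !big_cons /= addrA uv -mulrDl.
by rewrite -[intZmod.addz _ _]/(u.1 + v.1) intrD.
Qed.

Lemma pnull_eval rank p : pnull rank p -> peval p = 0.
Proof.
rewrite /pnull => /allP p0.
have -> : peval p = peval (foldr pinsert [::]
    [seq (u.1, sort (fun x y => rank x <= rank y)%N u.2) | u <- p]).
  elim: {p0}p => //= u p IH; rewrite peval_insert -IH /peval big_cons /=.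
  by congr (_ * _ + _); apply: perm_big; rewrite perm_sym perm_sort.
by rewrite /peval big1_seq // => u /andP[_ /p0/eqP->]; rewrite mul0r.
Qed.

End Evaluation.

Lemma peval_morph (B C : comNzRingType) (h : {rmorphism B -> C}) (env : T -> B) p :
  h (peval env p) = peval (h \o env) p.
Proof.
rewrite /peval rmorph_sum; apply: eq_bigr => u _.
by rewrite rmorphM rmorph_int rmorph_prod.
Qed.

End FormalPolynomials.

Definition prename (T U : eqType) (h : T -> U) (p : fpoly T) : fpoly U :=
  [seq (u.1, map h u.2) | u <- p].

Lemma peval_rename (T U : eqType) (h : T -> U) (B : comNzRingType) (env : U -> B) p :
  peval env (prename h p) = peval (env \o h) p.
Proof. by rewrite /peval big_map; apply: eq_bigr => u _; rewrite big_map. Qed.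

(** * Subsets of 'I_n as bit sequences *)

Section Bits.
Variable n : nat.
Implicit Types (b c u : bitseq).

(** Bit sequences compute: a statement about all subsets becomes a boolean over [ball n], decided by
    evaluation. *)
Definition bset b : {set 'I_n} := [set i : 'I_n | nth false b i].
Definition bbits (S : {set 'I_n}) : bitseq := [seq i \in S | i <- enum 'I_n].
Definition bdiff u b : bitseq := [seq x.1 && ~~ x.2 | x <- zip u b].

Fixpoint ball (k : nat) : seq bitseq :=
  if k is k'.+1 then
    let r := ball k' in map (cons false) r ++ map (cons true) r
  else [:: [::]].

Fixpoint bsubs u : seq bitseq :=
  if u is x :: u' then
    let r := bsubs u' in
    map (cons false) r ++ (if x then map (cons true) r else [::])
  else [:: [::]].

(** The head of [c], if present, is crossed by exactly the elements in the tail of [b], while the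
    head of [b] crosses nothing. *)
Fixpoint bcross b c : nat :=
  match b, c with
  | x :: b', y :: c' => ((if y then count id b' else 0) + bcross b' c')%N
  | _, _ => 0%N
  end.

Lemma size_bbits S : size (bbits S) = n.
Proof. by rewrite size_map size_enum_ord. Qed.

Lemma bbitsK S : bset (bbits S) = S.
Proof.
apply/setP => i; rewrite inE (nth_map i) ?size_enum_ord //.
by rewrite nth_ord_enum.
Qed.

Lemma bset_inj b c : size b = n -> size c = n -> bset b = bset c -> b = c.
Proof.
move=> sb sc /setP bc; apply: (@eq_from_nth _ false); rewrite sb ?sc // => i ilt.
by have := bc (Ordinal ilt); rewrite !inE.
Qed.

Lemma mem_ball k b : (b \in ball k) = (size b == k).
Proof.
elim: k b => [|k IH] [|x b] //=; rewrite mem_cat.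
  by apply/negP => /orP[] /mapP[].
have ci y : injective (cons y : bitseq -> bitseq) by move=> ? ? [].
case: x.
  rewrite (mem_map (ci true)) IH; case: mapP => // -[]; by [].
rewrite (mem_map (ci false)) IH; case: mapP => [[]//|_]; by rewrite orbF.
Qed.

Lemma bdiff_nth u b i : size u = size b ->
  nth false (bdiff u b) i = nth false u i && ~~ nth false b i.
Proof.
move=> s; have [iu|ui] := ltnP i (size u).
  rewrite (nth_map (false, false)) ?size_zip -?s ?minnn // nth_zip //.
by rewrite !nth_default ?size_map ?size_zip -?s ?minnn.
Qed.

Lemma size_bdiff u b : size u = size b -> size (bdiff u b) = size u.
Proof. by move=> s; rewrite size_map size_zip -s minnn. Qed.

Lemma bset_diff u b : size u = size b -> bset (bdiff u b) = bset u :\: bset b.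
Proof. by move=> s; apply/setP => i; rewrite !inE bdiff_nth // andbC. Qed.

Lemma bsubs_uniq u : uniq (bsubs u).
Proof.
elim: u => //= x u IH; rewrite cat_uniq.
have cu y : uniq (map (cons y) (bsubs u)) by rewrite map_inj_uniq // => ? ? [].
rewrite cu /=; case: x; rewrite /= ?cu ?andbT //.
by apply/hasPn => _ /mapP[b _ ->]; apply/mapP => -[].
Qed.

Lemma mem_bsubs u b : (b \in bsubs u) =
  (size b == size u) && all (fun x => x.2 ==> x.1) (zip u b).
Proof.
elim: u b => [|x u IH] [|y b] //=; rewrite mem_cat.
  by apply/negP => /orP[/mapP[]|] //; case: x => // /mapP[].
have ci z : injective (cons z : bitseq -> bitseq) by move=> ? ? [].
have nc z : (y :: b \in map (cons z) (bsubs u)) = (y == z) && (b \in bsubs u).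
  apply/mapP/andP => [[c cu [-> ->]]|[/eqP-> bu]]; first by rewrite eqxx.
  by exists b.
rewrite eqSS nc IH; case: x; rewrite ?nc ?IH ?in_nil; case: y {nc} => /=; rewrite ?orbF ?andbF //.
Qed.

Lemma subs_size u b : b \in bsubs u -> size b = size u.
Proof. by rewrite mem_bsubs => /andP[/eqP]. Qed.

Lemma sum_subsets (B : nmodType) u (F : {set 'I_n} -> B) : size u = n ->
  \sum_(S : {set 'I_n} | S \subset bset u) F S = \sum_(b <- bsubs u) F (bset b).
Proof.
move=> su; rewrite -(big_map bset predT F) big_uniq; last first.
  rewrite map_inj_in_uniq ?bsubs_uniq // => b c /subs_size sb /subs_size sc.
  by apply: bset_inj; rewrite ?sb ?sc su.
apply: eq_bigl => S; apply/subsetP/mapP => [Su|[b bu ->]].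
  exists (bbits S); last by rewrite bbitsK.
  rewrite mem_bsubs size_bbits su eqxx; apply/(all_nthP (false, false)) => i.
  rewrite size_zip size_bbits su minnn => ilt.
  rewrite nth_zip ?size_bbits ?su //=; apply/implyP.
  have := Su (Ordinal ilt); rewrite inE /= => H iS; apply: H.
  by rewrite -(bbitsK S) inE.
move: bu; rewrite mem_bsubs => /andP[/eqP sb /(all_nthP (false, false)) H] i.
rewrite !inE => ib; have := H i; rewrite size_zip sb minnn su ltn_ord => /(_ isT).
by rewrite nth_zip //= ib.
Qed.

Lemma card_bset b : size b = n -> #|bset b| = count id b.
Proof.
move=> sb; rewrite -sum1_card big_mkcond /=.
under eq_bigr do rewrite inE.
rewrite -(big_mkord predT (fun i => if nth false b i then 1%N else 0%N)) /= -{1}sb.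
by rewrite -sum1_count [RHS](big_nth false) [RHS]big_mkcond.
Qed.

Lemma bcrossE b c : size b = n -> size c = n ->
  crossings (bset b) (bset c) = bcross b c.
Proof.
have E (k : nat) d e : size d = k -> size e = k -> bcross d e =
    (\sum_(i < k) \sum_(j < k) (nth false d i && (nth false e j && (j < i))))%N.
  elim: k d e => [|k IH] [|x d] [|y e] //=; first by rewrite big_ord0.
  move=> [sd] [se]; rewrite big_ord_recl /= big1 ?add0n => [|j _]; last by rewrite !andbF.
  under eq_bigr do rewrite big_ord_recl /= ltnS leq0n andbT.
  rewrite big_split /= IH //; congr addn.
  case: y => /=; last by rewrite big1 // => i _; rewrite andbF.
  rewrite -sum1_count (big_nth false) big_mkcond /= sd big_mkord.
  by apply: eq_bigr => i _; rewrite andbT; case: nth.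
move=> sb sc; rewrite (E n) // pair_big /= /crossings -sum1_card big_mkcond /=.
by apply: eq_bigr => -[i j] _; rewrite !inE /=; case: (_ && _).
Qed.

End Bits.

(** * Formal Grassmann elements *)

Definition psgn (k : nat) : int := if odd k then -1 else 1.

Lemma psgnE (B : comNzRingType) k : (psgn k)%:~R = (-1) ^+ k :> B.
Proof. by rewrite -signr_odd /psgn; case: odd. Qed.

Section GrassModel.
Variable T : eqType.
Implicit Types (M N : bitseq -> fpoly T) (b u : bitseq).

Definition gmulM M N u : fpoly T :=
  psum (bsubs u) (fun b => pscale (psgn (bcross b (bdiff u b)))
                             (pmul (M b) (N (bdiff u b)))).
Definition ggenM n (a : nat) b : fpoly T :=
  if b == mkseq (pred1 a) n then pconst T 1 else [::].
Definition gderivM (a : nat) M b : fpoly T :=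
  if nth false b a then [::]
  else pscale (psgn (count id (take a b))) (M (set_nth false b a true)).
Definition gparityM M b : fpoly T := pscale (psgn (count id b)) (M b).

Variables (B : comNzRingType) (env : T -> B) (n : nat).
Implicit Types G H : grass B n.

(** Each operation on [grass] has a formal twin, and a lemma [models_...] carries this relation
    through it. A formal identity thus yields one between the elements themselves. *)
Definition models G M : Prop :=
  forall b, size b = n -> peval env (M b) = G (bset n b).

Lemma models_mul G H M N :
  models G M -> models H N -> models (gmul G H) (gmulM M N).
Proof.
move=> GM HN u su; rewrite peval_sum /gmul sum_subsets //.
apply: eq_big_seq => b /subs_size sb; have sub : size u = size b by rewrite sb.
rewrite peval_scale peval_mul psgnE GM ?sb // HN ?size_bdiff //.
by rewrite -bset_diff // bcrossE ?sb ?size_bdiff // mulrA.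
Qed.

Lemma models_gen (a : 'I_n) : models (ggen B a) (ggenM n a).
Proof.
move=> b sb; rewrite /ggenM /ggen /gmono.
have -> : [set a] = bset n (mkseq (pred1 (a : nat)) n).
  by apply/setP => i; rewrite !inE nth_mkseq.
case: eqP => [->|ne]; first by rewrite peval_const eqxx.
rewrite peval_nil; case: eqP => // /bset_inj e; case: ne; apply: e => //.
by rewrite size_mkseq.
Qed.

Lemma models_deriv (a : 'I_n) G M :
  models G M -> models (gderiv a G) (gderivM a M).
Proof.
move=> GM b sb; rewrite /gderivM /gderiv inE; case: ifP => [_|ba].
  exact: peval_nil.
rewrite peval_scale psgnE GM; last first.
  by rewrite size_set_nth sb; apply/maxn_idPr; apply: ltn_ord.
congr ((-1) ^+ _ * G _); last first.
  by apply/setP => i; rewrite !inE nth_set_nth /= -val_eqE; case: eqP.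
have st : size (take a b) = a by rewrite size_takel // sb ltnW.
rewrite -sum1_count (big_nth false) st big_mkcond /=.
rewrite -sum1_card [RHS]big_mkcond /=.
under [RHS]eq_bigr do rewrite !inE andbC.
rewrite -(big_mkord predT (fun i => if (i < a)%N && nth false b i then 1%N else 0%N)) /=.
rewrite [RHS](@big_cat_nat _ _ _ a) //= ?(ltnW (ltn_ord a)) //.
rewrite [X in (_ = _ + X)%N]big_nat_cond [X in (_ = _ + X)%N]big1 ?addn0.
  by rewrite [RHS]big_nat_cond [LHS]big_nat_cond; apply: eq_bigr => i /andP[/andP[_ ia] _];
    rewrite ia nth_take.
by move=> i /andP[/andP[ai _] _]; rewrite ltnNge ai.
Qed.

Lemma models_parity G M : models G M -> models (gparity G) (gparityM M).
Proof.
by move=> GM b sb; rewrite /gparityM /gparity peval_scale psgnE GM // card_bset.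
Qed.

End GrassModel.

Lemma grass_sumE (F : fieldType) k n (I : Type) (r : seq I) (G : I -> grass (fps F k) n) S :
  (\sum_(i <- r) G i) S = \sum_(i <- r) G i S.
Proof. by elim/big_rec2: _ => // i y z _ <-. Qed.

(** * Brackets in K(1,6) *)

Section KModel.
Variable T : eqType.
Implicit Types (M N : bitseq -> fpoly T) (d : T -> fpoly T).

Definition keulerM M b : fpoly T :=
  psum (seq.iota 0 6) (fun a => gmulM (ggenM T 6 a) (gderivM a M) b).
Definition kdtM d M b : fpoly T := pderiv d (M b).
Definition k2EM M b : fpoly T := pscale 2 (M b) ++ pscale (-1) (keulerM M b).
(** For i = 1, 2, 3 the positions of xi_i and eta_i among the six generators are [i.-1] and
    [i.+2]. *)
Definition kbracketM d M N b : fpoly T :=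
  (gmulM (k2EM M) (kdtM d N) b ++ pscale (-1) (gmulM (kdtM d M) (k2EM N) b))
  ++ psum [:: 1; 2; 3]%N (fun i =>
       gmulM (gderivM i.-1 (gparityM M)) (gderivM i.+2 N) b
       ++ gmulM (gderivM i.+2 (gparityM M)) (gderivM i.-1 N) b).

Variables (F : numClosedFieldType) (env : T -> fps F 1).
Implicit Types f g : K16 F.

Lemma models_euler f M : models env f M -> models env (Keuler f) (keulerM M).
Proof.
move=> fM b sb; rewrite /keulerM peval_sum /Keuler grass_sumE.
rewrite [RHS](eq_bigr (fun a : 'I_6 => peval env (gmulM (ggenM T 6 a) (gderivM a M) b))).
  by rewrite -(big_mkord predT (fun a => peval env (gmulM (ggenM T 6 a) (gderivM a M) b))).
by move=> a _; rewrite (models_mul (models_gen env a) (models_deriv a fM)).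
Qed.

Lemma models_kdt d f M :
  (forall x, fps_deriv ord0 (env x) = peval env (d x)) ->
  models env f M -> models env (Kdt f) (kdtM d M).
Proof.
move=> denv fM b sb; rewrite /kdtM /Kdt -fM //.
exact: (@peval_deriv _ _ _ (@fps_deriv F 1 ord0) _ _ (@fps_derivM _ _ _)).
Qed.

Lemma models_k2E f M : models env f M -> models env (f *+ 2 - Keuler f) (k2EM M).
Proof.
move=> fM b sb; rewrite /k2EM peval_cat !peval_scale fM // (models_euler fM) //.
by rewrite mulN1r mulr_natl.
Qed.

Lemma xi_val i : (0 < i < 7)%N -> xi i = i.-1 :> nat.
Proof. by case: i => // i /andP[_ i6]; rewrite /xi inordK. Qed.

Lemma bar_val (a : 'I_6) : bar a = ((a + 3) %% 6)%N :> nat.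
Proof. by rewrite /bar inordK // ltn_mod. Qed.

Lemma eta_val i : (0 < i < 4)%N -> eta i = i.+2 :> nat.
Proof.
by move=> i4; rewrite /eta bar_val xi_val; move: i i4 => [|[|[|[|i]]]].
Qed.

Lemma models_kbracket d f g M N :
  (forall x, fps_deriv ord0 (env x) = peval env (d x)) ->
  models env f M -> models env g N ->
  models env (Kbracket f g) (kbracketM d M N).
Proof.
move=> denv fM gN b sb.
have fd := models_kdt denv fM; have gd := models_kdt denv gN.
have [fE gE] := (models_k2E fM, models_k2E gN).
have fp := models_parity fM.
rewrite /kbracketM peval_cat [X in X + _]peval_cat peval_scale mulN1r
  [X in _ + X]peval_sum.
rewrite (models_mul fE gd) // (models_mul fd gE) //.
rewrite /Kbracket; apply: (congr2 +%R) => //; rewrite grass_sumE.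
apply: eq_big_seq => i i3; have i4 : (0 < i < 4)%N by move: i i3; do 4?case=> //.
have i7 : (0 < i < 7)%N by case/andP: i4 => -> /leq_trans->.
rewrite peval_cat -(xi_val i7) -(eta_val i4).
rewrite (models_mul (models_deriv (xi i) fp) (models_deriv (eta i) gN)) //.
by rewrite (models_mul (models_deriv (eta i) fp) (models_deriv (xi i) gN)).
Qed.

End KModel.

(** * The operator A *)

(** The complement of the barred set, that is, the support of xi_I^# when [b] is the support of
    xi_I. *)
Definition bdual (b : bitseq) : bitseq :=
  [seq ~~ nth false b ((i + 3) %% 6) | i <- seq.iota 0 6].
Definition bword (b : bitseq) : seq nat := [seq i <- seq.iota 0 6 | nth false b i].

Fixpoint ninversions (s : seq nat) : nat :=
  if s is i :: s' then (count (fun j => j < i)%N s' + ninversions s')%N else 0%N.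

(* The sign of xi_T in A(xi_S), where T is the set b and S its dual. *)
Definition bsign (b : bitseq) : nat :=
  let k := count id (bdual b) in
  ((k * (k + 1)) %/ 2
   + (ninversions ([seq (i + 3) %% 6 | i <- bword (bdual b)] ++ bword b)
      + ninversions [:: 1; 2; 3; 4; 5; 0]))%N.

Lemma ninversionsE n (s : seq 'I_n) : inversions s = ninversions (map val s).
Proof. by elim: s => //= a s ->; rewrite count_map. Qed.

Lemma val_enum_bset (b : bitseq) : map val (enum (bset 6 b)) = bword b.
Proof.
rewrite /bword -val_enum_ord filter_map; congr map.
by rewrite enumT; apply: eq_filter => i; rewrite /= inE.
Qed.

Lemma bset_dual b : size b = 6%N -> bset 6 (bdual b) = ~: (@bar @: bset 6 b).
Proof.
move=> sb; apply/setP => i; rewrite !inE (nth_map 0%N) ?size_iota // nth_iota // add0n.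
congr (~~ _); rewrite -bar_val; apply/idP/imsetP => [bi|[j + ->]]; last by rewrite inE barK.
by exists (bar i); rewrite ?inE ?barK.
Qed.

Lemma size_bdual b : size (bdual b) = 6%N.
Proof. by []. Qed.

Lemma bdualE b : size b = 6%N -> bdual (bdual b) = b.
Proof.
move=> sb; have : all (fun b => bdual (bdual b) == b) (ball 6) by vm_compute.
by move=> /allP H; apply/eqP/H; rewrite mem_ball sb.
Qed.

Lemma bword_sorted b : size b = 6%N -> ninversions (bword b) = 0%N.
Proof.
move=> sb; have : all (fun b => ninversions (bword b) == 0%N) (ball 6) by vm_compute.
by move=> /allP H; apply/eqP/H; rewrite mem_ball sb.
Qed.

Section Aop.
Variable F : numClosedFieldType.
Implicit Types (f g : K16 F) (b : bitseq).

(** The list [[:: 1; 2; 3; 4; 5; 0]] gives the positions of xi_2 xi_3 xi_4 eta_2 eta_3 eta_4; it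
    ends with 0 because eta_4 = xi_1. *)
Lemma sharpE b (T : {set 'I_6}) : size b = 6%N ->
  sharp F (enum (bset 6 (bdual b))) T =
  if T == bset 6 b then
    (-1) ^+ (ninversions ([seq (i + 3) %% 6 | i <- bword (bdual b)] ++ bword b)
             + ninversions [:: 1; 2; 3; 4; 5; 0])%N
  else 0.
Proof.
move=> sb; rewrite /sharp.
set J := [seq a <- enum 'I_6 | _].
have JE : J = enum (bset 6 b).
  rewrite /J enumT; apply: eq_filter => a /=.
  have -> : (a \in [seq bar i | i <- enum (bset 6 (bdual b))]) =
      (a \in @bar @: bset 6 (bdual b)).
    apply/mapP/imsetP => -[i iS ->]; exists i => //; move: iS; by rewrite mem_enum.
  have -> : @bar @: bset 6 (bdual b) = ~: bset 6 b.
    by rewrite -[in RHS](bdualE sb) [in RHS]bset_dual ?size_bdual // setCK.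
  by rewrite inE negbK.
rewrite JE gprodE ?enum_uniq // /bscale /gmono.
have -> : [set x in enum (bset 6 b)] = bset 6 b by apply/setP => x; rewrite inE mem_enum.
case: eqP => _; last by rewrite !mulr0.
rewrite !ninversionsE val_enum_bset bword_sorted // map_cat val_enum_bset mulr1 mulr1.
congr (_ ^+ (ninversions (_ ++ _) + ninversions _)).
  rewrite -val_enum_bset -!map_comp; apply: eq_map => i /=; exact: bar_val.
by rewrite /xi_top /= eta4 !xi_val // !eta_val.
Qed.

Lemma AopE f b : size b = 6%N -> Aop f (bset 6 b) =
  (-1) ^+ bsign b * dt_pow3B (count id (bdual b)) (f (bset 6 (bdual b))).
Proof.
move=> sb; rewrite /Aop grass_sumE (bigD1 (bset 6 (bdual b))) // big1 ?addr0.
  rewrite /bscale sharpE // eqxx card_bset ?size_bdual // /bsign.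
  by rewrite [in RHS]exprD [RHS]mulrAC [LHS]addr0.
move=> S /= ne; rewrite /bscale -(bbitsK S) -[bbits S]bdualE ?size_bbits //.
rewrite sharpE ?size_bdual //.
case: eqP => [e|_]; last by rewrite mulr0.
case/eqP: ne; rewrite (bset_inj sb (size_bdual _) e) bdualE ?size_bbits //.
by rewrite bbitsK.
Qed.

Lemma iotaE f b : size b = 6%N -> iota16 f (bset 6 b) =
  f (bset 6 b)
  + (-1) ^+ bsign b * dt_pow3B (count id (bdual b)) (f (bset 6 (bdual b))).
Proof. by move=> sb; rewrite -AopE. Qed.

Lemma count_bdual b : size b = 6%N -> count id (bdual b) = (6 - count id b)%N.
Proof.
move=> sb; have : all (fun b => count id (bdual b) == (6 - count id b)%N) (ball 6) by vm_compute.
by move=> /allP H; apply/eqP/H; rewrite mem_ball sb.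
Qed.

(** Equal signs make A an involution on the coordinates with |S| = 3, which is the identity
    iota(A(xi_I)) = iota(xi_I). *)
Lemma bsign_dual b : size b = 6%N -> odd (bsign (bdual b)) = odd (bsign b).
Proof.
move=> sb; have : all (fun b => odd (bsign (bdual b)) == odd (bsign b)) (ball 6) by vm_compute.
by move=> /allP H; apply/eqP/H; rewrite mem_ball sb.
Qed.

End Aop.

(** * The table of values of Psi *)

(* Generators 0, ..., 5 as in K16. *)
Definition nxi (k : nat) : nat := k.-1.
Definition neta (k : nat) : nat := ((k.-1 + 3) %% 6)%N.
Definition cycles : seq (nat * nat * nat) :=
  [:: (2, 3, 4); (3, 4, 2); (4, 2, 3)]%N.

Definition ev (k : nat) : nat := k.-1.
Definition od (k : nat) : nat := (k + 3)%N.
Definition xmono (z : int) (s : seq nat) : fpoly nat := [:: (z, s)].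

(* A row holds a word I and the coordinates of the coefficient of f_I in Psi f:
   ev k stands for d/dx_k, od k for (sqrt 2 / 2) dx_k, and the variable k for
   x_k. This coefficient is Psi (iota xi_I), except that it is one half of it
   when xi_I^# = xi_I, as then iota xi_I = 2 xi_I. When |I| = 3, only one word
   is kept out of I and I^#. *)
Definition psi_rows : seq (seq nat * seq (nat * fpoly nat)) :=
  [:: ([::], [:: (ev 1, xmono 1 [::])]);
      ([:: neta 2; neta 3; neta 4], [:: (od 1, xmono (-1) [::])])]
  ++ flatten [seq let: (i, j, k) := c in
    [:: ([:: nxi i; neta j], [:: (ev i, xmono 1 [:: j])]);
        ([:: nxi i; neta k], [:: (ev i, xmono 1 [:: k])]);
        ([:: neta i; neta j], [:: (ev k, xmono 1 [::])]);
        ([:: neta i], [:: (od i, xmono 1 [::])]);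
        ([:: nxi i; neta i],
         [:: (ev j, xmono (-1) [:: j]); (ev k, xmono (-1) [:: k])]);
        ([:: nxi i], [:: (od k, xmono (-1) [:: j]); (od j, xmono 1 [:: k])]);
        ([:: nxi j; neta j; neta i], [:: (od 1, xmono 2 [:: i])]);
        ([:: nxi i; nxi j],
         [:: (ev 2, xmono 1 [:: k; 2]); (ev 3, xmono 1 [:: k; 3]);
             (ev 4, xmono 1 [:: k; 4])]);
        ([:: nxi j; nxi i; neta i], [:: (od 1, xmono 2 [:: i; k])]);
        ([:: nxi i; nxi j; neta k], [:: (od 1, xmono (-1) [:: k; k])])]%N
    | c <- cycles].

Definition row_poly (c : nat) (cps : seq (nat * fpoly nat)) : fpoly nat :=
  flatten [seq cp.2 | cp <- cps & cp.1 == c].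

Definition wbits (w : seq nat) : bitseq := [seq i \in w | i <- seq.iota 0 6].

Definition row_bits : seq bitseq :=
  Eval vm_compute in [seq wbits r.1 | r <- psi_rows].

Lemma row_bitsE : row_bits = [seq wbits r.1 | r <- psi_rows].
Proof. by []. Qed.

Lemma wbits_inj : {in unzip1 psi_rows &, injective wbits}.
Proof.
have : all (fun w => all (fun w' => (wbits w == wbits w') ==> (w == w'))
  (unzip1 psi_rows)) (unzip1 psi_rows) by vm_compute.
move=> H w w' wr w'r /eqP e; apply/eqP.
by have /allP/(_ _ wr)/allP/(_ _ w'r)/implyP/(_ e) := H.
Qed.

(** * The subalgebra E(1,6) *)

Definition fps_derivn (F : fieldType) n (i : 'I_n) k (p : fps F n) : fps F n :=
  iter k (fps_deriv i) p.

Lemma fps_derivn_is_linear (F : fieldType) n (i : 'I_n) k :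
  linear (@fps_derivn F n i k).
Proof. by move=> a p q; elim: k => //= k; rewrite /fps_derivn /= => ->; rewrite linearP. Qed.

HB.instance Definition _ (F : fieldType) n (i : 'I_n) k :=
  GRing.isLinear.Build F (fps F n) (fps F n) *:%R (@fps_derivn F n i k)
    (fps_derivn_is_linear i k).

Lemma fps_scaleAr (F : fieldType) n (a : F) (p q : fps F n) :
  p * (a *: q) = a *: (p * q).
Proof. by rewrite mulrC -scalerAl mulrC. Qed.

Section E16Theory.
Variable F : numClosedFieldType.
Implicit Types (f g : K16 F) (b : bitseq).

Lemma dt_pow3B_low k (p : fps F 1) : (k <= 3)%N ->
  dt_pow3B k p = fps_derivn ord0 (3 - k) p.
Proof. by rewrite -subn_eq0 /dt_pow3B => /eqP->. Qed.

Lemma dt_pow3B_high k (p : fps F 1) : (3 <= k)%N ->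
  dt_pow3B k p = iter (k - 3) (fps_int ord0) p.
Proof. by rewrite /dt_pow3B => k3; have /eqP-> : (3 - k == 0)%N by rewrite subn_eq0. Qed.

Lemma fps_derivn_intK k (p : fps F 1) :
  fps_derivn ord0 k (iter k (fps_int ord0) p) = p.
Proof. by elim: k p => // k IH p; rewrite iterS /fps_derivn iterSr fps_intK [LHS]IH. Qed.

Definition self_dual f : Prop := forall b, size b = 6%N -> (3 <= count id b)%N ->
  f (bset 6 b) =
  (-1) ^+ bsign b * fps_derivn ord0 (count id b - 3) (f (bset 6 (bdual b))).

Lemma count_bits b : size b = 6%N -> (count id b <= 6)%N.
Proof. by move=> sb; rewrite -[X in (_ <= X)%N]sb count_size. Qed.

Lemma bsign_dualE b : size b = 6%N ->
  (-1) ^+ bsign (bdual b) = (-1) ^+ bsign b :> fps F 1.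
Proof. by move=> sb; rewrite -signr_odd bsign_dual // signr_odd. Qed.

(** Let D be d/dt, J the integral from 0, k = |S| - 3 and S* the dual of S. The coordinates of iota
    f are f_S +/- D^k f_{S*} at S and f_{S*} +/- J^k f_S at S*, with the same sign. As D^k J^k = 1,
    applying +/- D^k to the second gives the first. *)
Lemma iota_self_dual f : self_dual (iota16 f).
Proof.
move=> b sb b3; rewrite !iotaE ?size_bdual // bdualE // bsign_dualE // count_bdual //.
have c6 : (6 - count id b <= 3)%N by rewrite leq_subLR (leq_add2r 3 3).
rewrite dt_pow3B_low // dt_pow3B_high // raddfD raddfMsign /= fps_derivn_intK.
rewrite mulrDr [X in _ = _ + X]mulrA -exprD addnn -[X in _ = _ + X * _]signr_odd.
rewrite odd_double mul1r addrC.
by congr (_ * fps_derivn _ _ _ + _); rewrite subnBA ?count_bits // (addnC 3) (subnDr 3 _ 3).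
Qed.

(** Twice the weight in [cut]: iota doubles the coordinate at a set of the table that is its own
    dual, so this set gets the weight 1/2 and the other sets of the table get 1. *)
Definition cut2 b : nat :=
  if b \in row_bits then (if bdual b == b then 1 else 2)%N else 0%N.

(* A preimage of f under iota, supported on the words of the table. *)
Definition cut f : K16 F := fun S =>
  ((cut2 (bbits S))%:R / 2 : F) *: f S.

Lemma bbits_bset b : size b = 6%N -> bbits (bset 6 b) = b.
Proof. by move=> sb; apply: (@bset_inj 6); rewrite ?size_bbits ?bbitsK. Qed.

(** The equation at [b] reads f_S = - f_S. *)
Lemma anti_self_dual f b : self_dual f -> size b = 6%N -> count id b = 3%N ->
  bdual b = b -> odd (bsign b) -> f (bset 6 b) = 0.
Proof.
move=> fd sb b3 bb bo; have := fd b sb; rewrite b3 bb => /(_ isT).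
rewrite /fps_derivn subnn /= -signr_odd bo mulN1r => e.
have {e} : (2 : F) *: f (bset 6 b) = 0 by rewrite scaler_nat mulr2n {1}e addNr.
by move/eqP; rewrite scaler_eq0 pnatr_eq0 => /eqP.
Qed.

Lemma cut_self_dual f : self_dual f -> iota16 (cut f) = f.
Proof.
move=> fd; apply/funext => S; rewrite -(bbitsK S).
move: (bbits S) (size_bbits S) => b sb.
rewrite iotaE // /cut !bbits_bset ?size_bdual // count_bdual //.
(* Below size 3 the set has weight 1 and its dual, of size at least 4, has weight 0. From size 3 on,
   the equation at [b] turns both terms of iota into multiples of f_S, and the weights of [b] and
   its dual add up to 1, except at the sets with sign -1, where f_S = 0. *)
have : all (fun b => if (count id b <= 2)%N then (cut2 b == 2%N) && (cut2 (bdual b) == 0%N)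
   else (cut2 b + cut2 (bdual b) == 2)%N
        || [&& count id b == 3%N, bdual b == b & odd (bsign b)])
   (ball 6) by vm_compute.
move/allP/(_ b); rewrite mem_ball sb eqxx => /(_ isT); case: leqP => [b2|b3].
  case/andP=> /eqP-> /eqP->; rewrite mul0r scale0r divff ?pnatr_eq0 // scale1r.
  have b4 : (3 <= 6 - count id b)%N by rewrite leq_subRL ?count_bits // (@leq_add2r 3 _ 3) ltnW.
  rewrite dt_pow3B_high // [iter _ _ _](_ : _ = 0) ?mulr0 ?addr0 //.
  elim: (_ - _)%N => //= k ->; apply/funext => m; rewrite /fps_int.
  by case: ifP => // _; apply: mul0r.
have c6 : (6 - count id b <= 3)%N by rewrite leq_subLR (leq_add2r 3 3).
rewrite dt_pow3B_low // linearZ /=.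
have -> : (3 - (6 - count id b) = count id b - 3)%N.
  by rewrite subnBA ?count_bits // (addnC 3) (subnDr 3 _ 3).
rewrite fps_scaleAr -fd // -scalerDl -mulrDl -natrD.
case/orP=> [/eqP->|/and3P[/eqP c3 /eqP bb bo]]; first by rewrite divff ?pnatr_eq0 // scale1r.
by rewrite (anti_self_dual fd) // scaler0.
Qed.

Lemma inE16P f : f \in @inE16 F <-> self_dual f.
Proof.
split=> [/asboolP[g <-]|fd]; first exact: iota_self_dual.
by apply/asboolP; exists (cut f); apply: cut_self_dual.
Qed.

End E16Theory.

(** * Closure of E(1,6) under the bracket *)

(* (s, k, b) stands for the k-th derivative of the coordinate b of the first
   or second argument of the bracket. *)
Definition kvar : Type := (bool * nat * bitseq)%type.
Definition kvar_deriv (v : kvar) : fpoly kvar := pvar (v.1.1, v.1.2.+1, v.2).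
(** A monomial of a bracket has one factor from each argument, so the side alone orders its
    factors. *)
Definition kvar_rank (v : kvar) : nat := v.1.1.

(* The sets outside of the table that are their own dual satisfy
   xi_S^# = - xi_S, so that f_S = 0. *)
Definition egen (s : bool) (b : bitseq) : fpoly kvar :=
  if b \in row_bits then pvar (s, 0%N, b)
  else if bdual b == b then [::]
  else pscale (psgn (bsign b)) (pvar (s, (count id b - 3)%N, bdual b)).

Definition ebracket (b : bitseq) : fpoly kvar :=
  kbracketM kvar_deriv (egen false) (egen true) b.

Definition closure_check (b : bitseq) : bool :=
  pnull kvar_rank
    (ebracket b
     ++ pscale (- psgn (bsign b))
          (iter (count id b - 3) (pderiv kvar_deriv) (ebracket (bdual b)))).

Section Closure.
Variable F : numClosedFieldType.
Implicit Types (f g : K16 F) (b : bitseq).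

Definition kenv f g (v : kvar) : fps F 1 :=
  fps_derivn ord0 v.1.2 ((if v.1.1 then g else f) (bset 6 v.2)).

Lemma kenv_deriv f g v :
  fps_deriv ord0 (kenv f g v) = peval (kenv f g) (kvar_deriv v).
Proof. by rewrite peval_var. Qed.

Lemma models_egen f g s : self_dual (if s then g else f) ->
  models (kenv f g) (if s then g else f) (egen s).
Proof.
move=> sd b sb; rewrite /egen.
have : all (fun b => [|| b \in row_bits,
    [&& bdual b == b, count id b == 3%N & odd (bsign b)] |
    (bdual b != b) && (3 <= count id b)%N]) (ball 6) by vm_compute.
move/allP/(_ b); rewrite mem_ball sb eqxx => /(_ isT).
case: ifP => [_ _|_]; first by rewrite peval_var.
rewrite orFb; case: eqP => [bb|_]; last first.
  by case/orP=> // b3; rewrite peval_scale psgnE peval_var [RHS]sd.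
case/orP=> [/andP[_ /andP[/eqP b3 bo]]|//].
by rewrite peval_nil (anti_self_dual sd).
Qed.

Lemma closure_checked : all (fun b => (count id b <= 2)%N || closure_check b) (ball 6).
Proof. by vm_compute. Qed.

Lemma models_ebracket f g : self_dual f -> self_dual g ->
  models (kenv f g) (Kbracket f g) ebracket.
Proof.
move=> fd gd; apply: models_kbracket; first exact: kenv_deriv.
  exact: (@models_egen f g false).
exact: (@models_egen f g true).
Qed.

Lemma Kbracket_self_dual f g :
  self_dual f -> self_dual g -> self_dual (Kbracket f g).
Proof.
move=> fd gd b sb b3; have M := models_ebracket fd gd.
have := allP closure_checked b; rewrite mem_ball sb eqxx leqNgt b3 => /(_ isT) /=.
move/(pnull_eval (kenv f g)); rewrite peval_cat M // peval_scale rmorphN /= psgnE.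
have -> k : peval (kenv f g) (iter k (pderiv kvar_deriv) (ebracket (bdual b))) =
    fps_derivn ord0 k (Kbracket f g (bset 6 (bdual b))).
  elim: k => [|k IH]; first by rewrite /= M.
  rewrite iterS (@peval_deriv _ _ _ (@fps_deriv F 1 ord0)) ?IH //.
    exact: fps_derivM.
  exact: kenv_deriv.
by rewrite mulNr => /eqP; rewrite subr_eq0 => /eqP.
Qed.

End Closure.

(** * Brackets in E(4,4) *)

(* inl k is x_k, and inr v is v evaluated at t = 2 x_1, whence the factor 2 in
   its derivative. *)
Definition evar : Type := (nat + kvar)%type.
(** [inord] sends a value out of range to 0; with the same default, [x_indexE] holds for every
    [k]. *)
Definition x_index (k : nat) : nat := if (k.-1 < 4)%N then k.-1 else 0%N.
Definition evar_deriv (j : nat) (v : evar) : fpoly evar :=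
  match v with
  | inl k => if x_index k == j then pconst _ 1 else [::]
  | inr v => if j == 0%N
             then pscale 2 (pvar (inr (v.1.1, v.1.2.+1, v.2) : evar)) else [::]
  end.
(** With 5 above the indices of the x_k, a sorted monomial lists the x_k first, then the factor from
    the first argument, then the one from the second. *)
Definition evar_rank (v : evar) : nat :=
  match v with inl k => k | inr v => (5 + v.1.1)%N end.

(** Coordinates refer to increasing monomials, whereas the rows keep the words as prescribed;
    [ninversions] gives the sign between the two. *)
Definition psiM (M : bitseq -> fpoly kvar) (c : nat) : fpoly evar :=
  psum psi_rows (fun r => psum r.2 (fun cp =>
    if cp.1 == c then
      pmul (pscale (psgn (ninversions r.1)) (prename inr (M (wbits r.1))))
           (prename inl cp.2)
    else [::])).

Section EModel.
Implicit Types X Y w v : nat -> fpoly evar.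
Local Notation pd j := (pderiv (evar_deriv j)).

Definition vf_bracketM X Y (i : nat) : fpoly evar :=
  psum (seq.iota 0 4) (fun j =>
    pmul (X j) (pd j (Y i)) ++ pscale (-1) (pmul (Y j) (pd j (X i)))).
Definition lieM X w (i : nat) : fpoly evar :=
  psum (seq.iota 0 4) (fun j => pmul (X j) (pd j (w i)) ++ pmul (w j) (pd i (X j))).
Definition divM X : fpoly evar := psum (seq.iota 0 4) (fun j => pd j (X j)).
(** Twice the action, to clear the 1/2 in front of the divergence. *)
Definition act2M X w (i : nat) : fpoly evar :=
  pscale 2 (lieM X w i) ++ pscale (-1) (pmul (divM X) (w i)).
Definition formM w (b : bitseq) : fpoly evar :=
  psum (seq.iota 0 4) (fun i => pmul (w i) (ggenM evar 4 i b)).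
Definition ext_dM (M : bitseq -> fpoly evar) (b : bitseq) : fpoly evar :=
  psum (seq.iota 0 4) (fun i => gmulM (ggenM evar 4 i) (fun b => pd i (M b)) b).
Definition form_bracketM w v (i : nat) : fpoly evar :=
  let b := mkseq (predC1 i) 4 in
  pscale (psgn i) (gmulM (ext_dM (formM w)) (formM v) b
                   ++ gmulM (formM w) (ext_dM (formM v)) b).

End EModel.

Definition psi_gen (s : bool) (c : nat) : fpoly evar := psiM (egen s) c.
Definition psi_gen_odd (s : bool) (c : nat) : fpoly evar := psi_gen s (4 + c).

(* Odd coordinates are in units of sqrt 2 / 2, so that the bracket of two odd
   elements comes with a factor 1/2; both checks are multiplied by 2. *)
Definition even_check (i : nat) : bool :=
  pnull evar_rank
    (pscale 2 (psiM ebracket i)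
     ++ pscale (-1)
          (pscale 2 (vf_bracketM (psi_gen false) (psi_gen true) i)
           ++ form_bracketM (psi_gen_odd false) (psi_gen_odd true) i)).
Definition odd_check (i : nat) : bool :=
  pnull evar_rank
    (pscale 2 (psiM ebracket (4 + i))
     ++ pscale (-1)
          (act2M (psi_gen false) (psi_gen_odd true) i
           ++ pscale (-1) (act2M (psi_gen true) (psi_gen_odd false) i))).

Lemma peval_sum_iota (T : eqType) (B : comNzRingType) (env : T -> B) n f :
  peval env (psum (seq.iota 0 n) f) = \sum_(i < n) peval env (f i).
Proof.
by rewrite peval_sum -(big_mkord predT (fun i => peval env (f i))) /index_iota subn0.
Qed.

Section EModels.
Variables (F : numClosedFieldType) (env : evar -> fps F 4).
Hypothesis env_deriv : forall (j : 'I_4) v,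
  fps_deriv j (env v) = peval env (evar_deriv j v).

Let derivE (j : 'I_4) p :
  peval env (pderiv (evar_deriv j) p) = fps_deriv j (peval env p).
Proof.
exact: (@peval_deriv _ _ _ (@fps_deriv F 4 j) _ _ (@fps_derivM _ _ _) (env_deriv j)).
Qed.

Definition models4 (u : 'I_4 -> fps F 4) (M : nat -> fpoly evar) : Prop :=
  forall i : 'I_4, peval env (M i) = u i.

Lemma models_vf_bracket (X Y : W4 F) M N : models4 X M -> models4 Y N ->
  models4 (vf_bracket X Y) (vf_bracketM M N).
Proof.
move=> XM YN i; rewrite peval_sum_iota; apply: eq_bigr => j _.
by rewrite peval_cat peval_scale !peval_mul !derivE XM YN XM YN mulN1r.
Qed.

Lemma models_act (X : W4 F) (w : Omega1 F) M N : models4 X M -> models4 w N ->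
  models4 (W4_act X w *+ 2) (act2M M N).
Proof.
move=> XM wN i; rewrite peval_cat !peval_scale peval_mul wN.
have -> : peval env (divM M) = divergence X.
  by rewrite peval_sum_iota; apply: eq_bigr => j _; rewrite derivE XM.
have -> : peval env (lieM M N i) = lie_derivative X w i.
  rewrite peval_sum_iota; apply: eq_bigr => j _.
  by rewrite peval_cat !peval_mul !derivE !XM !wN.
rewrite mulN1r mulr_natl [RHS](_ : _ = (W4_act X w i) *+ 2) //.
rewrite [W4_act X w i](_ : _ = lie_derivative X w i - 2^-1 *: (divergence X * w i)) //.
rewrite mulrnBl; congr (_ - _).
by rewrite -scaler_nat scalerA mulfV ?pnatr_eq0 // scale1r.
Qed.

Lemma models_form (w : Omega1 F) M : models4 w M ->
  models env (form_of_Omega1 w) (formM M).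
Proof.
move=> wM b sb; rewrite peval_sum_iota /form_of_Omega1 grass_sumE.
by apply: eq_bigr => i _; rewrite peval_mul wM (models_gen env i).
Qed.

Lemma models_ext_d (th : form F) M : models env th M ->
  models env (ext_d th) (ext_dM M).
Proof.
move=> thM b sb; rewrite peval_sum_iota /ext_d grass_sumE.
apply: eq_bigr => i _.
rewrite (@models_mul _ _ _ _ _ (fun S => fps_deriv i (th S)) _ _ (models_gen env i)) //.
by move=> c sc; rewrite derivE thM.
Qed.

Lemma models_form_bracket (w v : Omega1 F) M N : models4 w M -> models4 v N ->
  models4 (form_bracket w v) (form_bracketM M N).
Proof.
move=> wM vN i; rewrite /form_bracketM peval_scale psgnE peval_cat.
have [fw fv] := (models_form wM, models_form vN).
have [dw dv] := (models_ext_d fw, models_ext_d fv).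
have sb : size (mkseq (predC1 (i : nat)) 4) = 4%N by rewrite size_mkseq.
rewrite (models_mul dw fv) // (models_mul fw dv) //.
have -> : bset 4 (mkseq (predC1 (i : nat)) 4) = [set~ i].
  by apply/setP => j; rewrite !inE nth_mkseq.
by [].
Qed.

End EModels.

(** * The map Psi and its compatibility with the brackets *)

Section PsiMap.
Variable F : numClosedFieldType.
Implicit Types (f g : K16 F) (c : nat).

Local Notation sigma := (@fps_subst F 3 2).

Definition psi_coef f c : fps F 4 :=
  \sum_(r <- psi_rows) \sum_(cp <- r.2)
    if cp.1 == c then
      (-1) ^+ ninversions r.1 * sigma (f (bset 6 (wbits r.1)))
        * peval (x_ F) cp.2
    else 0.

Lemma psi_coef_is_linear c : linear (psi_coef^~ c).
Proof.
move=> a f g; rewrite /psi_coef scaler_sumr -big_split; apply: eq_bigr => r _ /=.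
rewrite scaler_sumr -big_split; apply: eq_bigr => cp _ /=.
case: eqP => _; last by rewrite scaler0 addr0.
rewrite [(a *: f + g) _](_ : _ = a *: f (bset 6 (wbits r.1)) + g (bset 6 (wbits r.1))) //.
by rewrite linearP /= mulrDr mulrDl fps_scaleAr -scalerAl.
Qed.

Definition psi16 f : E44 F :=
  ((fun i : 'I_4 => psi_coef f i) : W4 F,
   (sqrtC 2 / 2) *: ((fun i : 'I_4 => psi_coef f (4 + i)) : Omega1 F)).

Lemma psi16_is_linear : linear psi16.
Proof.
move=> a f g; congr (_, _).
  by apply/funext => i; rewrite psi_coef_is_linear.
pose w h : Omega1 F := fun i : 'I_4 => psi_coef h (4 + i).
have wL : w (a *: f + g) = a *: w f + w g.
  by apply/funext => i; rewrite /w psi_coef_is_linear.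
rewrite -[LHS]/((sqrtC 2 / 2) *: w _) wL scalerDr scalerA mulrC -(scalerA a).
by [].
Qed.

Definition Psi (f : E16 F) : E44 F := psi16 (f : K16 F).

Lemma Psi_is_linear : linear Psi.
Proof. by move=> a f g; rewrite /Psi -psi16_is_linear. Qed.

HB.instance Definition _ := GRing.isLinear.Build F (E16 F) (E44 F) *:%R Psi
  Psi_is_linear.

Definition eenv f g (v : evar) : fps F 4 :=
  match v with inl k => x_ F k | inr v => sigma (kenv f g v) end.

Lemma x_indexE k : (inord k.-1 : 'I_4) = x_index k :> nat.
Proof. by rewrite val_insubd. Qed.

Lemma eenv_deriv f g (j : 'I_4) v :
  fps_deriv j (eenv f g v) = peval (eenv f g) (evar_deriv j v).
Proof.
case: v => [k|v]; rewrite /eenv /evar_deriv.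
  rewrite fps_deriv_var -x_indexE eq_sym -val_eqE.
  by case: eqP => _; rewrite ?peval_const ?peval_nil.
case: eqP => [j0|/eqP j0].
  have -> : j = ord0 by apply: val_inj.
  rewrite fps_deriv_subst0 peval_scale peval_var.
  by rewrite [RHS]mulr_natl scaler_nat.
by rewrite peval_nil fps_deriv_subst.
Qed.

(** As [sigma] is a ring morphism, it commutes with the evaluation of formal coordinates. *)
Lemma psi_coefE f g h M c : models (kenv f g) h M ->
  peval (eenv f g) (psiM M c) = psi_coef h c.
Proof.
move=> hM; rewrite peval_sum; apply: eq_bigr => r _.
rewrite peval_sum; apply: eq_bigr => cp _.
case: eqP => _; last by rewrite peval_nil.
rewrite peval_mul peval_scale psgnE !peval_rename; congr (_ * _ * _).
by rewrite -hM // peval_morph.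
Qed.

Lemma even_checked : all even_check (seq.iota 0 4).
Proof. by vm_compute. Qed.

Lemma odd_checked : all odd_check (seq.iota 0 4).
Proof. by vm_compute. Qed.

Lemma form_bracketZ a b (w v : Omega1 F) :
  form_bracket (a *: w) (b *: v) = (a * b) *: form_bracket w v.
Proof.
have gmulZZ (th th' : form F) : gmul (a *: th) (b *: th') = (a * b) *: (gmul th th' : form F).
  apply/funext => U; rewrite [RHS](_ : _ = (a * b) *: gmul th th' U) // /gmul.
  rewrite scaler_sumr; apply: eq_bigr => S _.
  rewrite [(a *: th) S](_ : _ = a *: th S) // [(b *: th') _](_ : _ = b *: th' (U :\: S)) //.
  by rewrite !fps_scaleAr -!scalerAl scalerA mulrC.
have formZ (c : F) (u : Omega1 F) : form_of_Omega1 (c *: u) = c *: form_of_Omega1 u :> form F.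
  rewrite /form_of_Omega1 scaler_sumr; apply: eq_bigr => i _; apply/funext => S.
  by rewrite [RHS](_ : _ = c *: (u i * ggen _ i S)) // scalerAl.
have extZ (c : F) (th : form F) : ext_d (c *: th) = c *: ext_d th :> form F.
  rewrite /ext_d scaler_sumr; apply: eq_bigr => i _; apply/funext => U.
  rewrite [RHS](_ : _ = c *: gmul (ggen _ i) (fun S => fps_deriv i (th S)) U) // /gmul.
  rewrite scaler_sumr; apply: eq_bigr => S _.
  rewrite [(c *: th) _](_ : _ = c *: th (U :\: S)) // linearZ /=.
  exact: fps_scaleAr.
apply/funext => i; rewrite /form_bracket !formZ !extZ !gmulZZ -scalerDr.
set th : form F := gmul _ _ + _.
by rewrite /vf_of_form3 [(_ *: th) _](_ : _ = (a * b) *: th [set~ i]) // fps_scaleAr.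
Qed.

Lemma W4_actZ (X : W4 F) a (w : Omega1 F) : W4_act X (a *: w) = a *: W4_act X w.
Proof.
apply/funext => i.
rewrite [RHS](_ : _ = a *: (lie_derivative X w i - 2^-1 *: (divergence X * w i))) //.
rewrite [LHS](_ : _ = lie_derivative X (a *: w) i - 2^-1 *: (divergence X * (a *: w i))) //.
rewrite scalerBr fps_scaleAr !scalerA (mulrC a); congr (_ - _).
rewrite /lie_derivative scaler_sumr; apply: eq_bigr => j _.
rewrite [(a *: w) i](_ : _ = a *: w i) // [(a *: w) j](_ : _ = a *: w j) //.
by rewrite linearZ /= fps_scaleAr -scalerAl scalerDr.
Qed.

Lemma psi16_bracket f g : self_dual f -> self_dual g ->
  psi16 (Kbracket f g) = Ebracket (psi16 f) (psi16 g).
Proof.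
move=> fd gd.
have hM c : peval (eenv f g) (psiM ebracket c) = psi_coef (Kbracket f g) c.
  exact/psi_coefE/models_ebracket.
have fM c : peval (eenv f g) (psi_gen false c) = psi_coef f c.
  exact/psi_coefE/(@models_egen _ f g false).
have gM c : peval (eenv f g) (psi_gen true c) = psi_coef g c.
  exact/psi_coefE/(@models_egen _ f g true).
have dE := eenv_deriv f g.
have fXM : models4 (eenv f g) (psi16 f).1 (psi_gen false) by move=> i; exact: fM.
have gXM : models4 (eenv f g) (psi16 g).1 (psi_gen true) by move=> i; exact: gM.
pose wf : Omega1 F := fun i : 'I_4 => psi_coef f (4 + i).
pose wg : Omega1 F := fun i : 'I_4 => psi_coef g (4 + i).
have fwM : models4 (eenv f g) wf (psi_gen_odd false) by move=> i; exact: fM.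
have gwM : models4 (eenv f g) wg (psi_gen_odd true) by move=> i; exact: gM.
have r2 : (sqrtC 2 / 2) * (sqrtC 2 / 2) = 2^-1 :> F.
  by rewrite mulrACA -expr2 sqrtCK mulrA divff ?mul1r // pnatr_eq0.
have two : injective (fun p : fps F 4 => p *+ 2).
  move=> p q /eqP; rewrite -subr_eq0 -mulrnBl -scaler_nat scaler_eq0 pnatr_eq0 /=.
  by rewrite subr_eq0 => /eqP.
congr (_, _).
  rewrite form_bracketZ r2; apply/funext => i.
  have := allP even_checked i; rewrite mem_iota /= => /(_ (ltn_ord i)).
  move/(pnull_eval (eenv f g)).
  rewrite peval_cat peval_scale hM [X in _ + X]peval_scale [X in _ + _ * X]peval_cat.
  rewrite [X in _ + _ * (X + _)]peval_scale.
  rewrite (models_vf_bracket dE fXM gXM) (models_form_bracket dE fwM gwM).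
  rewrite mulN1r => /eqP; rewrite subr_eq0 => /eqP e; apply: two => /=.
  rewrite [LHS](etrans (esym (mulr_natl _ _)) e).
  rewrite [RHS](_ : _ = (vf_bracket (psi16 f).1 (psi16 g).1 i
    + 2^-1 *: form_bracket wf wg i) *+ 2) //.
  rewrite mulrnDl -[X in _ = X + _]mulr_natl; congr (_ + _).
  by rewrite -scaler_nat scalerA divff ?scale1r // pnatr_eq0.
rewrite /psi16 /= !W4_actZ -scalerBr; congr (_ *: _); apply/funext => i.
have := allP odd_checked i; rewrite mem_iota /= => /(_ (ltn_ord i)).
move/(pnull_eval (eenv f g)).
rewrite peval_cat peval_scale hM [X in _ + X]peval_scale [X in _ + _ * X]peval_cat.
rewrite [X in _ + _ * (_ + X)]peval_scale.
rewrite [X in _ + _ * (X + _)](models_act dE fXM gwM)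
  [X in _ + _ * (_ + _ * X)](models_act dE gXM fwM).
rewrite !mulN1r => /eqP; rewrite subr_eq0 => /eqP e; apply: two => /=.
rewrite [LHS](etrans (esym (mulr_natl _ _)) e).
by rewrite [RHS](_ : _ = (W4_act (psi16 f).1 wg i - W4_act (psi16 g).1 wf i) *+ 2)
  // [RHS]mulrnBl.
Qed.

End PsiMap.

(** * Parity, and the values of Psi on t^n xi_I *)

Section Values.
Variable F : numClosedFieldType.
Implicit Types (f g : K16 F) (b : bitseq) (c : nat) (I : seq 'I_6).

Local Notation sigma := (@fps_subst F 3 2).

Lemma Psi_parity : preserves_parity (@Psi F).
Proof.
have par : all (fun r => all (fun cp =>
    (cp.1 < 4)%N == ~~ odd (count id (wbits r.1))) r.2) psi_rows.
  by vm_compute.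
have z f c : (forall r, r \in psi_rows -> (c < 4)%N = ~~ odd (count id (wbits r.1)) ->
    f (bset 6 (wbits r.1)) = 0) -> psi_coef f c = 0.
  move=> H; rewrite /psi_coef big1_seq // => r /andP[_ rr].
  rewrite big1_seq // => cp /andP[_ cpr]; case: eqP => // cE.
  rewrite H ?raddf0 ?mulr0 ?mul0r // -cE.
  by have /allP/(_ _ cpr)/eqP := allP par _ rr.
have cw w : #|bset 6 (wbits w)| = count id (wbits w) by rewrite card_bset.
move=> f; split=> fp.
  have p0 (i : 'I_4) : psi_coef f (4 + i) = 0.
    by apply: z => r _ /= /esym/negbFE o; apply: fp; rewrite cw.
  have w0 : (fun i : 'I_4 => psi_coef f (4 + i)) = 0 :> Omega1 F by apply/funext.
  by rewrite -[LHS]/((sqrtC 2 / 2) *: (_ : Omega1 F)) w0 scaler0.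
apply/funext => i; apply: z => r _ e; apply: fp.
by rewrite cw -e ltn_ord.
Qed.

Lemma Psi_bracket : preserves_bracket (@Psi F).
Proof.
move=> f g.
have fd : self_dual f by apply/inE16P; apply: e16P.
have gd : self_dual g by apply/inE16P; apply: e16P.
have hE : Kbracket f g \in @inE16 F by apply/inE16P/Kbracket_self_dual.
by exists (MkE16 hE); split=> //; apply: psi16_bracket.
Qed.

Lemma gprod_bset I b : uniq I -> size b = 6%N ->
  gprod (fps F 1) I (bset 6 b) =
  if b == wbits (map val I) then (-1) ^+ ninversions (map val I) else 0.
Proof.
move=> uI sb; rewrite gprodE // /bscale /gmono ninversionsE.
have -> : [set x in I] = bset 6 (wbits (map val I)).
  apply/setP => i; rewrite !inE (nth_map 0%N) ?size_iota // nth_iota // add0n.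
  by rewrite mem_map //; apply: val_inj.
case: (b =P _) => [->|ne]; first by rewrite eqxx mulr1.
case: eqP => [|_]; last by rewrite mulr0.
by move/bset_inj => e; case: ne; apply: e.
Qed.

Lemma count_wbits I : uniq I -> count id (wbits (map val I)) = size I.
Proof.
move=> uI; rewrite -(@card_bset 6) // -(card_uniqP uI); apply: eq_card => i.
rewrite !inE (nth_map 0%N) ?size_iota // nth_iota // add0n.
by rewrite mem_map //; apply: val_inj.
Qed.

Lemma dt_pow3B0 k : dt_pow3B k 0 = 0 :> fps F 1.
Proof.
have [k3|/ltnW k3] := leqP k 3; first by rewrite dt_pow3B_low // linear0.
rewrite dt_pow3B_high //; elim: (k - 3)%N => //= n ->; apply/funext => m.
by rewrite /fps_int; case: ifP => // _; apply: mul0r.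
Qed.

(** When |S| < 3 the dual of S has more than 3 elements, so p xi_I has no coordinate there and A
    contributes nothing. When |S| = 3, A involves neither derivative nor integral, hence commutes
    with multiplication by p. The coordinates with |S| <= 3 are those read by Psi. *)
Lemma iota_bscale (p : fps F 1) I b : uniq I -> (size I <= 3)%N ->
  size b = 6%N -> (count id b <= 3)%N ->
  iota16 (p ** gprod _ I : K16 F) (bset 6 b) = p * iota16 (gprod _ I : K16 F) (bset 6 b).
Proof.
move=> uI sI sb b3; rewrite !iotaE // mulrDr; congr (_ + _).
rewrite /bscale gprod_bset ?size_bdual // count_bdual //.
case: eqP => [e|_]; last by rewrite mulr0 dt_pow3B0 !mulr0.
have c3 : count id b = 3%N.
  apply/eqP; rewrite eqn_leq b3 /= -(leq_add2l 3); apply: leq_trans (leq_add sI (leqnn _)).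
  by rewrite -(count_wbits uI) -e count_bdual // subnK ?count_bits.
by rewrite c3 /dt_pow3B /= mulrCA.
Qed.

Lemma row_count r : r \in psi_rows -> (count id (wbits r.1) <= 3)%N.
Proof.
move=> rr; have : all (fun r => count id (wbits r.1) <= 3)%N psi_rows by vm_compute.
by move/allP/(_ _ rr).
Qed.

Lemma x_1E : x_ F 1 = fps_var F ord0.
Proof. by congr (fps_var F _); apply: val_inj; rewrite /= inordK. Qed.

Lemma subst_t_exp n : sigma (t_ F ^+ n) = 2 ^+ n *: x_ F 1 ^+ n.
Proof.
rewrite rmorphXn /= fps_subst_var -x_1E; elim: n => [|n IH]; first by rewrite !expr0 scale1r.
by rewrite !exprS IH fps_scaleAr -scalerAl scalerA mulrC.
Qed.

Lemma Psi_tn : prescribed_tn (@Psi F).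
Proof.
move=> n I _ uI sI.
have pE c : psi_coef (iota16 (t_ F ^+ n ** gprod _ I : K16 F)) c =
    2 ^+ n *: (x_ F 1 ^+ n * psi_coef (iota16 (gprod _ I : K16 F)) c).
  rewrite /psi_coef mulr_sumr scaler_sumr; apply: eq_big_seq => r rr.
  rewrite mulr_sumr scaler_sumr; apply: eq_bigr => cp _; case: eqP => _; last first.
    by rewrite mulr0 scaler0.
  rewrite iota_bscale ?row_count // rmorphM /= subst_t_exp -scalerAl fps_scaleAr -scalerAl.
  by congr (_ *: _); ring.
congr (_, _); first by apply/funext => i; rewrite pE.
apply/funext => i; pose psi g := psi_coef (iota16 g) (4 + i).
rewrite [LHS](_ : _ = (sqrtC 2 / 2) *: psi (t_ F ^+ n ** gprod _ I : K16 F)) //.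
rewrite [RHS](_ : _ = 2 ^+ n *: (x_ F 1 ^+ n * ((sqrtC 2 / 2) *: psi (gprod _ I)))) //.
by rewrite /psi pE fps_scaleAr !scalerA mulrC.
Qed.

Definition psi_poly (w : seq nat) (c : nat) : fpoly nat :=
  row_poly c (flatten [seq r.2 | r <- psi_rows & r.1 == w]).

(** Undoes the factor one half that the table carries when xi_I^# = xi_I. *)
Definition self_factor (w : seq nat) : nat :=
  if bdual (wbits w) == wbits w then 2%N else 1%N.

(** Within the table, A matters only at a word that is its own dual: sets of size less than 3 have
    duals of size more than 3, and no two distinct sets of the table are dual to each other. *)
Lemma iota_word I b : uniq I -> map val I \in unzip1 psi_rows -> b \in row_bits ->
  iota16 (gprod _ I : K16 F) (bset 6 b) =
  if b == wbits (map val I)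
  then (-1) ^+ ninversions (map val I) * (self_factor (map val I))%:R else 0.
Proof.
move=> uI /mapP[r rr wr] br.
have : all (fun r => all (fun b => [&& size b == 6%N,
     (count id b < 3)%N ==> (count id (bdual b) > 3)%N &
     (count id b == 3%N) ==> (bdual b == wbits r.1) ==>
       (b == wbits r.1) && ~~ odd (bsign b)]) row_bits) psi_rows by vm_compute.
move=> /allP/(_ _ rr)/allP/(_ _ br) /and3P[/eqP sb b2 bb].
have b3 : (count id b <= 3)%N.
  by move: br; rewrite row_bitsE => /mapP[r' rr' ->]; apply: row_count.
have w3 := row_count rr.
rewrite iotaE // !gprod_bset ?size_bdual // wr /self_factor.
have [c3|c3] := ltnP (count id b) 3.
  have {}b2 := implyP b2 c3.
  have -> : (bdual b == wbits r.1) = false.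
    by apply: contraTF b2 => /eqP ->; rewrite -leqNgt.
  rewrite dt_pow3B0 mulr0 addr0; case: eqP => // bw.
  case: eqP => [e|_]; last by rewrite mulr1.
  by move: b2; rewrite bw e -bw leqNgt ltnS (leq_trans _ c3) // leqnn.
have {c3 b3}c3 : count id b = 3%N by apply/eqP; rewrite eqn_leq b3.
rewrite count_bdual // c3 /dt_pow3B /=; move: bb; rewrite c3 /= => bb.
case: eqP bb => [bw /andP[/eqP e bo]|bw _].
  have so : (-1) ^+ bsign b = 1 :> fps F 1 by rewrite -signr_odd (negbTE bo).
  have db : bdual b = b by rewrite bw -e.
  by rewrite so mul1r -e db eqxx mulr_natr mulr2n.
rewrite mulr0 addr0; case: eqP => // e; rewrite -e; case: eqP => [e2|_]; last by rewrite mulr1.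
by case: bw; rewrite e2.
Qed.

Lemma psi_coef_word I c : uniq I -> map val I \in unzip1 psi_rows ->
  psi_coef (iota16 (gprod _ I : K16 F)) c =
  (self_factor (map val I))%:R * peval (x_ F) (psi_poly (map val I) c).
Proof.
move=> uI Ir; rewrite /psi_coef /psi_poly.
transitivity (\sum_(r <- psi_rows | r.1 == map val I) \sum_(cp <- r.2 | cp.1 == c)
    (self_factor (map val I))%:R * peval (x_ F) cp.2).
  rewrite [RHS]big_mkcond; apply: eq_big_seq => r rr; rewrite [in RHS]big_mkcond /=.
  have br : wbits r.1 \in row_bits.
    by rewrite row_bitsE; exact: (map_f (fun r => wbits r.1) rr).
  rewrite iota_word //.
  have -> : (wbits r.1 == wbits (map val I)) = (r.1 == map val I).
    apply/eqP/eqP => [/wbits_inj e|->] //.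
    by apply: e => //; apply: (map_f (fun r => r.1)).
  case: eqP => [->|_]; last first.
    by rewrite big1 // => cp _; case: eqP => // _; rewrite raddf0 mulr0 mul0r.
  apply: eq_bigr => cp _; case: eqP => // _.
  rewrite rmorphM rmorphXn rmorphN1 rmorph_nat mulrA -exprD addnn.
  by rewrite -[X in X * _ * _]signr_odd odd_double mul1r.
rewrite /row_poly /peval big_flatten big_map big_filter big_flatten big_map
  big_filter mulr_sumr.
apply: eq_bigr => r _; rewrite -mulr_sumr big_mkcond [in RHS]big_mkcond.
by [].
Qed.

End Values.

(** * The prescribed values for n = 0 *)

Section Prescribed.
Variable F : numClosedFieldType.
Implicit Types (f g : K16 F) (b : bitseq) (c : nat) (I : seq 'I_6).

Lemma eta_neta k : (0 < k < 7)%N -> eta k = neta k :> nat.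
Proof. by move=> k7; rewrite /eta bar_val xi_val. Qed.

(** As a constant series, sqrt 2 / 2 becomes an atom for [ring], and sqrt 2 becomes twice this
    atom. *)
Definition half_sqrt2 : fps F 4 := (sqrtC 2 / 2)%:A.

Lemma scale_half (p : fps F 4) : (sqrtC 2 / 2) *: p = half_sqrt2 * p.
Proof. by rewrite -scalerAl mul1r. Qed.

Lemma scale_sqrt2 (p : fps F 4) : sqrtC 2 *: p = 2 * half_sqrt2 * p.
Proof.
rewrite -mulrA mulr_natl -scale_half -scaler_nat scalerA mulrCA divff ?mulr1 //.
by rewrite pnatr_eq0.
Qed.

Definition delta (k i : nat) : fps F 4 := (i == k.-1)%:R.

Lemma ddxE k (i : 'I_4) : (k <= 4)%N -> (ddx F k).1 i = delta k i.
Proof.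
by case: k => [|k] k4; rewrite /delta /= -val_eqE /= inordK.
Qed.

Lemma dxE k (i : 'I_4) : (k <= 4)%N -> (dx F k).2 i = delta k i.
Proof.
by case: k => [|k] k4; rewrite /delta /= -val_eqE /= inordK.
Qed.

Lemma Psi_word I : uniq I -> map val I \in unzip1 psi_rows ->
  forall i : 'I_4,
  (Psi (iota (gprod (fps F 1) I))).1 i =
    (self_factor (map val I))%:R * peval (x_ F) (psi_poly (map val I) i) /\
  (Psi (iota (gprod (fps F 1) I))).2 i =
    half_sqrt2 * ((self_factor (map val I))%:R * peval (x_ F) (psi_poly (map val I) (4 + i))).
Proof.
move=> uI Ir i; rewrite -!psi_coef_word //; split=> //.
by rewrite -scale_half.
Qed.

Lemma E44_eq (a b : E44 F) :
  (forall i, a.1 i = b.1 i) -> (forall i, a.2 i = b.2 i) -> a = b.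
Proof.
by case: a b => [a1 a2] [b1 b2] H1 H2; congr (_, _); apply/funext.
Qed.

Lemma E44_add1 (a b : E44 F) i : (a + b).1 i = a.1 i + b.1 i. Proof. by []. Qed.
Lemma E44_add2 (a b : E44 F) i : (a + b).2 i = a.2 i + b.2 i. Proof. by []. Qed.
Lemma E44_opp1 (a : E44 F) i : (- a).1 i = - a.1 i. Proof. by []. Qed.
Lemma E44_opp2 (a : E44 F) i : (- a).2 i = - a.2 i. Proof. by []. Qed.
Lemma E44_scale1 z (a : E44 F) i : (z *: a).1 i = z *: a.1 i. Proof. by []. Qed.
Lemma E44_scale2 z (a : E44 F) i : (z *: a).2 i = z *: a.2 i. Proof. by []. Qed.
Lemma Escale1 p (a : E44 F) i : (Escale p a).1 i = p * a.1 i. Proof. by []. Qed.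
Lemma Escale2 p (a : E44 F) i : (Escale p a).2 i = p * a.2 i. Proof. by []. Qed.
Lemma ddx2 k i : (ddx F k).2 i = 0. Proof. by []. Qed.
Lemma dx1 k i : (dx F k).1 i = 0. Proof. by []. Qed.

Definition E44E := (E44_add1, E44_add2, E44_opp1, E44_opp2, E44_scale1,
  E44_scale2, Escale1, Escale2, ddx2, dx1).

Lemma uniq_word I w : map val I = w -> uniq w -> uniq I.
Proof. by move=> <- /map_uniq. Qed.

Lemma word_eq I w (a : E44 F) : map val I = w -> uniq w -> w \in unzip1 psi_rows ->
  (forall i : 'I_4, (self_factor w)%:R * peval (x_ F) (psi_poly w i) = a.1 i) ->
  (forall i : 'I_4, half_sqrt2 *
     ((self_factor w)%:R * peval (x_ F) (psi_poly w (4 + i))) = a.2 i) ->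
  Psi (iota (gprod (fps F 1) I)) = a.
Proof.
move=> Iw uw wr H1 H2; have W := @Psi_word I (uniq_word Iw uw); rewrite Iw in W.
by apply: E44_eq => i; rewrite ?(W wr i).1 ?(W wr i).2 ?H1 ?H2.
Qed.

End Prescribed.

Ltac coordinate_ring :=
  let i := fresh "i" in let lt := fresh "lt" in
  move=> i; rewrite ?E44E ?ddxE ?dxE // ?scaleNr ?scale_half ?scale_sqrt2;
  case: i => [[|[|[|[|//]]]] lt];
  (match goal with |- context [psi_poly ?w ?c] =>
     let p := eval vm_compute in (psi_poly w c) in change (psi_poly w c) with p end;
   match goal with |- context [self_factor ?w] =>
     let k := eval vm_compute in (self_factor w) in change (self_factor w) with k end;
   rewrite /peval ?big_cons ?big_nil /delta /= ?NegzE; ring).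

Ltac word w := apply: (@word_eq _ _ w);
  [by rewrite /= ?xi_val ?eta_neta | by [] | by [] | coordinate_ring | coordinate_ring ].

Section PrescribedValues.
Variable F : numClosedFieldType.

(** The value at eta_i eta_j eta_k is prescribed for all three cyclic orders, but the table has one
    row for it; a cyclic permutation of three odd factors is even. *)
Lemma gprod_eta_cycle I : I \in [:: [:: eta 3; eta 4; eta 2]; [:: eta 4; eta 2; eta 3]] ->
  gprod (fps F 1) I = gprod _ [:: eta 2; eta 3; eta 4].
Proof.
move=> Ic; have Iu : uniq I /\ odd (inversions I) = odd (inversions [:: eta 2; eta 3; eta 4]).
  move: Ic; rewrite !inE => /orP[]/eqP->; rewrite /= !inE -!val_eqE /= !eta_neta //.
rewrite !gprodE ?Iu.1 //; last first.
  by rewrite /= !inE -!val_eqE /= !eta_neta.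
rewrite -signr_odd Iu.2 signr_odd; congr (_ ** gmono _ _); apply/setP => x.
by move: Ic; rewrite !inE => /orP[]/eqP->; rewrite !inE; do 3 case: (x == _).
Qed.

Lemma Psi_n0 : prescribed_n0 (@Psi F).
Proof.
split; [|split].
- word (@nil nat).
- move=> i j; rewrite !inE => /or3P[]/eqP-> /or3P[]/eqP-> // _.
  + word [:: nxi 2; neta 3].
  + word [:: nxi 2; neta 4].
  + word [:: nxi 3; neta 2].
  + word [:: nxi 3; neta 4].
  + word [:: nxi 4; neta 2].
  + word [:: nxi 4; neta 3].
- move=> i j k; rewrite /cyclic234 !inE => /or3P[]/eqP[-> -> ->].
  + split; [word [:: neta 2; neta 3] |].
    split; [word [:: neta 2] |].
    split; [word [:: neta 2; neta 3; neta 4] |].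
    split; [word [:: nxi 2; neta 2] |].
    split; [word [:: nxi 2] |].
    split; [word [:: nxi 3; neta 3; neta 2] |].
    split; [word [:: nxi 2; nxi 3] |].
    split; [word [:: nxi 3; nxi 2; neta 2] |].
    word [:: nxi 2; nxi 3; neta 4].
  + split; [word [:: neta 3; neta 4] |].
    split; [word [:: neta 3] |].
    split; [rewrite (@gprod_eta_cycle [:: eta 3; eta 4; eta 2]);
            last (by rewrite !inE eqxx ?orbT);
            word [:: neta 2; neta 3; neta 4] |].
    split; [word [:: nxi 3; neta 3] |].
    split; [word [:: nxi 3] |].
    split; [word [:: nxi 4; neta 4; neta 3] |].
    split; [word [:: nxi 3; nxi 4] |].
    split; [word [:: nxi 4; nxi 3; neta 3] |].
    word [:: nxi 3; nxi 4; neta 2].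
  + split; [word [:: neta 4; neta 2] |].
    split; [word [:: neta 4] |].
    split; [rewrite (@gprod_eta_cycle [:: eta 4; eta 2; eta 3]);
            last (by rewrite !inE eqxx ?orbT);
            word [:: neta 2; neta 3; neta 4] |].
    split; [word [:: nxi 4; neta 4] |].
    split; [word [:: nxi 4] |].
    split; [word [:: nxi 2; neta 2; neta 4] |].
    split; [word [:: nxi 4; nxi 2] |].
    split; [word [:: nxi 2; nxi 4; neta 4] |].
    word [:: nxi 4; nxi 2; neta 3].
Qed.
End PrescribedValues.

(** * Adic order and continuity of Psi *)

Section Order.
Variables (F : fieldType) (n : nat).
Implicit Types p q : fps F n.

Definition vanish N p : Prop := forall m, (mdeg m < N)%N -> p m = 0.

Lemma vanishD N p q : vanish N p -> vanish N q -> vanish N (p + q).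
Proof.
by move=> pN qN m mN; rewrite [LHS](_ : _ = p m + q m) // pN // qN // addr0.
Qed.

Lemma vanishM N p q : vanish N p -> vanish N (p * q).
Proof.
move=> pN m mN; rewrite fps_mul_coef big1 // => k /eqP mE.
by rewrite pN ?mul0r // (leq_ltn_trans _ mN) // -ltnS bmdeg.
Qed.

Lemma vanishZ N a p : vanish N p -> vanish N (a *: p).
Proof. by move=> pN m mN; rewrite [LHS](_ : _ = a * p m) // pN // mulr0. Qed.

Lemma vanish_sum N (I : Type) (r : seq I) (P : pred I) (G : I -> fps F n) :
  (forall i, P i -> vanish N (G i)) -> vanish N (\sum_(i <- r | P i) G i).
Proof. by move=> GN; elim/big_rec: _ => // i p Pi; apply/vanishD/GN. Qed.

Lemma vanish_deriv N i p : vanish N.+1 p -> vanish N (fps_deriv i p).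
Proof.
by move=> pN m mN; rewrite /fps_deriv pN ?mul0rn // mdegD mdeg1 addn1.
Qed.

Lemma vanish_derivn N i k p : vanish (N + k) p -> vanish N (fps_derivn i k p).
Proof.
elim: k N => [|k IH] N; first by rewrite addn0.
by rewrite addnS -addSn => /IH; apply: vanish_deriv.
Qed.

End Order.

Lemma vanish_subst (F : fieldType) n (a : F) N p :
  vanish N p -> vanish N (@fps_subst F n a p).
Proof.
move=> pN m mN; rewrite /fps_subst; case: ifP => // _.
rewrite pN ?mulr0 // mdegMn mdeg1 mul1n (leq_ltn_trans _ mN) //.
by rewrite mdegE (bigD1 ord0) //= leq_addr.
Qed.

Section Continuity.
Variable F : numClosedFieldType.

Lemma Psi_continuous : adic_continuous (@Psi F).
Proof.
(* Psi differentiates nothing, and neither substitution nor multiplication lowers the order, so the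
   bound [N] itself works. *)
move=> N; exists N => f fN i m mN.
have v c : vanish N (psi_coef f c).
  apply: vanish_sum => r _; apply: vanish_sum => cp _; case: ifP => // _.
  by apply: vanishM; rewrite mulrC; apply/vanishM/vanish_subst/fN.
split; first exact: v.
exact: (@vanishZ _ _ N (sqrtC 2 / 2) _ (v (4 + i)%N) m mN).
Qed.

End Continuity.

(** * Injectivity *)

Section Injectivity.
Variable F : numClosedFieldType.
Implicit Types (f : K16 F) (s : seq nat).

Definition xexp s : seq nat :=
  [seq count (fun k => x_index k == i) s | i <- seq.iota 0 4].
Definition xmnm s : 'X_{1..4} := [multinom nth 0%N (xexp s) i | i < 4].

Lemma xmnmE s (i : 'I_4) : xmnm s i = count (fun k => x_index k == i) s.
Proof. by rewrite mnmE (nth_map 0%N) ?size_iota // nth_iota. Qed.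

Lemma prod_x s : \prod_(k <- s) x_ F k = fps_X F (xmnm s).
Proof.
elim: s => [|k s IH].
  rewrite big_nil; congr (fps_X F _); apply/mnmP => i; by rewrite xmnmE mnm0E.
rewrite big_cons IH fps_XM; congr (fps_X F _); apply/mnmP => i.
by rewrite mnmDE !xmnmE mnm1E /= -x_indexE.
Qed.

Lemma xmnm_eq s s' : (xmnm s == xmnm s') = (xexp s == xexp s').
Proof.
apply/eqP/eqP => [e|e]; last by rewrite /xmnm e.
apply: (@eq_from_nth _ 0%N) => // i i4.
by have := congr1 (fun a : 'X_{1..4} => a (Ordinal i4)) e; rewrite !mnmE.
Qed.

Definition sumz (s : seq int) : int := foldr intZmod.addz 0 s.
Definition row_coef (c : nat) s (cps : seq (nat * fpoly nat)) : int :=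
  sumz [seq u.1 | u <- row_poly c cps & xexp u.2 == xexp s].

Lemma sumzE (t : seq int) : sumz t = \sum_(z <- t) z.
Proof. exact: (foldrE (R := int)). Qed.

Lemma fps_sumE (K : fieldType) n (I : Type) (r : seq I) (G : I -> fps K n) m :
  (\sum_(i <- r) G i) m = \sum_(i <- r) G i m.
Proof. by elim/big_rec2: _ => // i y z _ <-. Qed.

Lemma fps_intM (K : fieldType) n (z : int) (p : fps K n) m :
  (z%:~R * p) m = z%:~R * p m.
Proof. by rewrite mulrzl -scaler_int. Qed.

Lemma psi_coef_rows f c : psi_coef f c =
  \sum_(r <- psi_rows) (psgn (ninversions r.1))%:~R *
    (fps_subst 2 (f (bset 6 (wbits r.1))) * peval (x_ F) (row_poly c r.2)).
Proof.
apply: eq_bigr => r _; rewrite /peval /row_poly big_flatten big_map big_filter.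
rewrite mulr_sumr mulr_sumr [RHS]big_mkcond; apply: eq_bigr => cp _.
by case: ifP => // _; rewrite psgnE mulrA.
Qed.

Definition x1_free s : bool := (xexp s)`_0%N == 0%N.

(** No polynomial of the table contains x_1, so the power of x_1 comes from f_I(2 x_1) alone.
    Injectivity is thereby reduced, for each k separately, to one integer linear system in the
    coefficients of t^k of the f_I. *)
Lemma psi_coef_mono f c s k : x1_free s ->
  psi_coef f c (xmnm s + U_(ord0) *+ k)%MM =
  \sum_(r <- psi_rows) (psgn (ninversions r.1))%:~R * ((row_coef c s r.2)%:~R
    * (2 ^+ k * f (bset 6 (wbits r.1)) (U_(ord0) *+ k)%MM)).
Proof.
have e00 u : x1_free u -> xmnm u ord0 = 0%N by rewrite mnmE => /eqP.
move=> s0; rewrite psi_coef_rows fps_sumE; apply: eq_big_seq => r rr.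
rewrite fps_intM; congr (_ * _); rewrite mulr_sumr fps_sumE /row_coef sumzE.
rewrite rmorph_sum big_map big_filter mulr_suml [RHS]big_mkcond.
have : all (fun r => all (fun u => x1_free u.2) (row_poly c r.2)) psi_rows.
  apply/allP => r' rr'; apply/allP => u /flattenP[p /mapP[cp]].
  rewrite mem_filter => /andP[_ cpr] -> up.
  have : all (fun r => all (fun cp => all (fun u => x1_free u.2) cp.2) r.2) psi_rows.
    by vm_compute.
  by move/allP/(_ _ rr')/allP/(_ _ cpr)/allP/(_ _ up).
move/allP/(_ _ rr)/allP => u0; apply: eq_big_seq => u ur.
rewrite mulrCA fps_intM prod_x fps_substMX_coef ?e00 ?u0 // xmnm_eq.
by case: ifP => // _; rewrite mulr0.
Qed.

(* A combination of coefficients of coordinates of Psi f that isolates f_I: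
   one coefficient is enough, except that xi_i eta_i is involved in the
   coefficients of x_j d/dx_j and x_k d/dx_k. *)
Definition witness (r : seq nat * seq (nat * fpoly nat)) :
    seq (int * (nat * seq nat)) :=
  let default := [seq (1, (cp.1, u.2)) | cp <- take 1 r.2, u <- take 1 cp.2] in
  if r.1 is [:: a; b] then
    if b == ((a + 3) %% 6)%N then
      [seq (if k.-1 == (if a == 0 then 3 else a)%N then 1 else -1, (ev k, [:: k]))
         | k <- [:: 2; 3; 4]%N]
    else default
  else default.

(** For the words xi_i eta_i, let c_i be the coefficient of x_i d/dx_i. By the table c_i = -(f_j +
    f_k), and cyclically, so c_i - c_j - c_k = 2 f_i, which is the origin of the weights 1 and
    -1. *)
Lemma witness_checked : all (fun r =>
  all (fun a => (a.2.1 < 8)%N && x1_free a.2.2) (witness r) &&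
  all (fun r' =>
    (sumz [seq intRing.mulz a.1 (row_coef a.2.1 a.2.2 r'.2) | a <- witness r] == 0)
      == (r' != r)) psi_rows) psi_rows.
Proof. by vm_compute. Qed.

Lemma psi_coef_eq0 f : (forall c, (c < 8)%N -> psi_coef f c = 0) ->
  forall r, r \in psi_rows -> f (bset 6 (wbits r.1)) = 0.
Proof.
move=> f0 r rr; apply/funext => m; rewrite (mnm1_ord1 m); move: (m ord0) => k {m}.
have /allP/(_ _ rr)/andP[/allP wa /allP wr] := witness_checked.
pose X (r : seq nat * seq (nat * fpoly nat)) : F :=
  2 ^+ k * f (bset 6 (wbits r.1)) (U_(ord0) *+ k)%MM.
pose S (r' : seq nat * seq (nat * fpoly nat)) : int :=
  sumz [seq intRing.mulz a.1 (row_coef a.2.1 a.2.2 r'.2) | a <- witness r].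
have : \sum_(a <- witness r) a.1%:~R * psi_coef f a.2.1 (xmnm a.2.2 + U_(ord0) *+ k)%MM = 0.
  by rewrite big1_seq // => a /andP[_ /wa/andP[a8 _]]; rewrite f0 // mulr0.
have -> : \sum_(a <- witness r) a.1%:~R * psi_coef f a.2.1 (xmnm a.2.2 + U_(ord0) *+ k)%MM
    = \sum_(r' <- psi_rows) (psgn (ninversions r'.1))%:~R * ((S r')%:~R * X r').
  transitivity (\sum_(a <- witness r) \sum_(r' <- psi_rows)
      (psgn (ninversions r'.1))%:~R * ((a.1 * row_coef a.2.1 a.2.2 r'.2)%:~R * X r')).
    apply: eq_big_seq => a /wa/andP[_ a0]; rewrite psi_coef_mono // mulr_sumr.
    by apply: eq_bigr => r' _; rewrite intrM mulrCA !mulrA.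
  rewrite exchange_big; apply: eq_bigr => r' _.
  by rewrite -mulr_sumr -mulr_suml /S sumzE big_map rmorph_sum.
rewrite (bigD1_seq r) //= big1_seq => [|r' /andP[ne rr']]; last first.
  have := wr _ rr'; rewrite ne => /eqP/eqP S0.
  by rewrite /S S0 mul0r mulr0.
have S1 : S r != 0 by have /eqP := wr _ rr; rewrite eqxx => /negbT.
rewrite addr0 => /eqP; rewrite psgnE mulf_eq0 signr_eq0 /= mulf_eq0 intr_eq0 (negbTE S1) /=.
by rewrite mulf_eq0 expf_eq0 pnatr_eq0 andbF /= => /eqP.
Qed.

Lemma Psi_injective : injective (@Psi F).
Proof.
move=> f g /eqP; rewrite -subr_eq0 -linearB => /eqP.
set h := f - g => h0; apply/eqP; rewrite -subr_eq0 -/h; apply/eqP.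
have hd : self_dual h by apply/inE16P; apply: e16P.
have r0 : (sqrtC 2 / 2 : F) != 0.
  by rewrite mulf_neq0 ?invr_eq0 ?sqrtC_eq0 ?pnatr_eq0.
have c0 c : (c < 8)%N -> psi_coef h c = 0.
  move=> c8; have [c4|c4] := ltnP c 4.
    exact: (congr1 (fun a : E44 F => a.1 (Ordinal c4)) h0).
  have c4' : (c - 4 < 4)%N by rewrite ltn_subLR.
  have /eqP := congr1 (fun a : E44 F => a.2 (Ordinal c4')) h0.
  rewrite [X in X == _](_ : _ = (sqrtC 2 / 2) *: psi_coef h (4 + (c - 4))) //.
  by rewrite [X in _ == X](_ : _ = 0) // scaler_eq0 (negbTE r0) subnKC // => /eqP.
(* The element is iota of its [cut], which only reads coordinates of the table, and these are now
   zero. *)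
apply: val_inj; rewrite -[LHS](cut_self_dual hd).
rewrite (_ : cut _ = 0) ?linear0 //; apply/funext => S; rewrite /cut /cut2.
case: ifP => [|_]; last by rewrite mul0r scale0r.
rewrite row_bitsE => /mapP[r rr E].
have hS : e16val h S = 0 by rewrite -(bbitsK S) E (psi_coef_eq0 c0).
by rewrite hS scaler0.
Qed.

End Injectivity.

(** * Uniqueness *)

Definition words : seq (seq 'I_6) :=
  [:: [::]; [:: eta 2; eta 3; eta 4]]
  ++ flatten [seq let: (i, j, k) := c in
    [:: [:: xi i; eta j]; [:: xi i; eta k]; [:: eta i; eta j]; [:: eta i];
        [:: xi i; eta i]; [:: xi i]; [:: xi j; eta j; eta i]; [:: xi i; xi j];
        [:: xi j; xi i; eta i]; [:: xi i; xi j; eta k]] | c <- cycles].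

Lemma words_val : [seq map val J | J <- words] = unzip1 psi_rows.
Proof. by rewrite /words /= !xi_val // !eta_neta. Qed.

Lemma words_uniq : uniq words.
Proof. by apply: (@map_uniq _ _ (map val)); rewrite words_val; vm_compute. Qed.

Lemma word_row (I : seq 'I_6) : I \in words -> map val I \in unzip1 psi_rows.
Proof. by move=> Iw; rewrite -words_val map_f. Qed.

Lemma word_uniq (I : seq 'I_6) : I \in words -> uniq I.
Proof.
move/word_row => Ir; apply: (@map_uniq _ _ val); move: (map val I) Ir.
by apply/allP; vm_compute.
Qed.

Lemma word_size (I : seq 'I_6) : I \in words -> (size I <= 3)%N.
Proof.
move/word_row => Ir; rewrite -(size_map val); move: (map val I) Ir.
by apply/(@allP _ (fun w => size w <= 3)%N); vm_compute.
Qed.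

Section Uniqueness.
Variable F : numClosedFieldType.
Implicit Types (Phi : {linear E16 F -> E44 F}) (f : K16 F) (I : seq 'I_6).

Lemma prescribed_n0_words Phi Phi' : prescribed_n0 Phi -> prescribed_n0 Phi' ->
  {in words, forall I, Phi (iota (gprod _ I)) = Phi' (iota (gprod _ I))}.
Proof.
move=> [A [B C]] [A' [B' C']] I; rewrite mem_cat => /orP[].
  rewrite !inE => /orP[]/eqP->; first by rewrite A A'.
  exact: etrans (C 2 3 4 isT).2.2.1 (esym (C' 2 3 4 isT).2.2.1).
case/flattenP=> s /mapP[[[i j] k] cE ->].
have Cc := C i j k cE; have Cc' := C' i j k cE.
have [ir [jr kr ij ik]] : [/\ i \in [:: 2; 3; 4]%N, j \in [:: 2; 3; 4]%N,
    k \in [:: 2; 3; 4]%N, i != j & i != k].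
  by move: cE; rewrite !inE => /or3P[]/eqP[-> -> ->].
rewrite !inE; do 10?[case/orP]; move/eqP->.
- exact: etrans (B i j ir jr ij) (esym (B' i j ir jr ij)).
- exact: etrans (B i k ir kr ik) (esym (B' i k ir kr ik)).
- exact: etrans Cc.1 (esym Cc'.1).
- exact: etrans Cc.2.1 (esym Cc'.2.1).
- exact: etrans Cc.2.2.2.1 (esym Cc'.2.2.2.1).
- exact: etrans Cc.2.2.2.2.1 (esym Cc'.2.2.2.2.1).
- exact: etrans Cc.2.2.2.2.2.1 (esym Cc'.2.2.2.2.2.1).
- exact: etrans Cc.2.2.2.2.2.2.1 (esym Cc'.2.2.2.2.2.2.1).
- exact: etrans Cc.2.2.2.2.2.2.2.1 (esym Cc'.2.2.2.2.2.2.2.1).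
- exact: etrans Cc.2.2.2.2.2.2.2.2 (esym Cc'.2.2.2.2.2.2.2.2).
Qed.

Lemma iota_is_linear : linear (@iota F).
Proof. by move=> a f g; apply: val_inj; apply: iota16_is_linear. Qed.

HB.instance Definition _ := GRing.isLinear.Build F (K16 F) (E16 F) *:%R (@iota F)
  iota_is_linear.

Definition bmul (I : seq 'I_6) (p : fps F 1) : K16 F := p ** gprod _ I.

Lemma bmul_is_linear I : linear (bmul I).
Proof.
move=> a p q; apply/funext => S.
rewrite [RHS](_ : _ = a *: (p * gprod _ I S) + q * gprod _ I S) //.
by rewrite [LHS]mulrDl scalerAl.
Qed.

HB.instance Definition _ I := GRing.isLinear.Build F (fps F 1) (K16 F) *:%R (bmul I)
  (bmul_is_linear I).

Lemma t_exp n : t_ F ^+ n = fps_X F (U_(ord0) *+ n)%MM.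
Proof. by elim: n => [|n IH]; rewrite ?expr0 ?mulm0n // exprS IH fps_XM -mulmS. Qed.

Definition fps_head N (p : fps F 1) : fps F 1 :=
  \sum_(n < N) (p (U_(ord0) *+ n)%MM : F) *: t_ F ^+ n.

Lemma fps_tail N (p : fps F 1) : vanish N (p - fps_head N p).
Proof.
move=> m mN; rewrite (mnm1_ord1 m) in mN *; move: (m ord0) mN => k.
rewrite mdegMn mdeg1 mul1n => kN.
rewrite [LHS](_ : _ = p (U_(ord0) *+ k)%MM - fps_head N p (U_(ord0) *+ k)%MM) //.
apply/eqP; rewrite subr_eq0 /fps_head fps_sumE; apply/eqP.
have E n : (p (U_(ord0) *+ n)%MM *: t_ F ^+ n) (U_(ord0) *+ k)%MM =
    p (U_(ord0) *+ n)%MM * (k == n)%:R :> F.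
  rewrite t_exp [LHS](_ : _ = p (U_(ord0) *+ n)%MM *
    ((U_(ord0) *+ k)%MM == (U_(ord0) *+ n)%MM :> 'X_{1..1})%:R) //.
  congr (_ * _%:R); congr nat_of_bool; apply/eqP/eqP => [|-> //].
  by move/(congr1 (fun a : 'X_{1..1} => a ord0)); rewrite !mulmnE mnm1E !mul1n.
rewrite (bigD1 (Ordinal kN)) //= big1 => [|n ne]; rewrite E.
  by rewrite eqxx mulr1 addr0.
by case: eqP => [kn|_]; [case/eqP: ne; apply: val_inj | rewrite mulr0].
Qed.

(** A differentiates at most three times, and integration does not lower the order; hence the margin
    3. *)
Lemma vanish_dt_pow3B N k (p : fps F 1) : vanish (N + 3) p -> vanish N (dt_pow3B k p).
Proof.
move=> pN; have [k3|/ltnW k3] := leqP k 3.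
  rewrite dt_pow3B_low //; apply: vanish_derivn => m mN; apply: pN.
  by rewrite (leq_trans mN) // leq_add2l leq_subr.
rewrite dt_pow3B_high //; elim: (k - 3)%N => [|n IH] m mN.
  by apply: pN; rewrite ltn_addr.
rewrite /= /fps_int; case: ifP => // /negbT m0; rewrite IH ?mul0r //.
apply: leq_ltn_trans mN; rewrite !mdegE; apply: leq_sum => i _.
by rewrite mnmBE leq_subr.
Qed.

Lemma vanish_iota N I (p : fps F 1) S : vanish (N + 3) p ->
  vanish N (iota16 (bmul I p) S).
Proof.
move=> pN; rewrite -(bbitsK S) iotaE ?size_bbits //.
have pN' : vanish N p by move=> m mN; apply: pN; rewrite ltn_addr.
apply: vanishD; first exact: vanishM.
by rewrite mulrC; apply/vanishM/vanish_dt_pow3B/vanishM.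
Qed.

Lemma adic_continuous_sub Phi Phi' : adic_continuous Phi -> adic_continuous Phi' ->
  adic_continuous (Phi \- Phi').
Proof.
move=> c c' N; have [[M cM] [M' cM']] := (c N, c' N).
exists (maxn M M') => f fM i m mN.
have [|a1 a2] := cM f _ i m mN.
  by move=> S m' m'M; apply: fM; rewrite leq_max m'M.
have [|b1 b2] := cM' f _ i m mN.
  by move=> S m' m'M; apply: fM; rewrite leq_max m'M orbT.
split.
  by rewrite [LHS](_ : _ = (Phi f).1 i m - (Phi' f).1 i m) // a1 b1 subrr.
by rewrite [LHS](_ : _ = (Phi f).2 i m - (Phi' f).2 i m) // a2 b2 subrr.
Qed.

(** Applied to f = iota(cut f), this writes an element of E(1,6) as a finite sum of iota(p xi_I).
    The power of -1 passes from increasing monomials to the words. *)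
Lemma cut_words f : cut f = \sum_(I <- words)
  bmul I (((cut2 (wbits (map val I)))%:R / 2 * (-1) ^+ ninversions (map val I) : F)
          *: f (bset 6 (wbits (map val I)))).
Proof.
apply/funext => S; rewrite -(bbitsK S); move: (bbits S) (size_bbits S) => b sb.
rewrite grass_sumE /cut bbits_bset //.
have E I : I \in words ->
    bmul I (((cut2 (wbits (map val I)))%:R / 2 * (-1) ^+ ninversions (map val I) : F)
          *: f (bset 6 (wbits (map val I)))) (bset 6 b) =
    if b == wbits (map val I) then ((cut2 b)%:R / 2 : F) *: f (bset 6 b) else 0.
  move=> Iw; rewrite /bmul /bscale gprod_bset ?word_uniq //.
  case: eqP => [->|_]; last by rewrite mulr0.
  rewrite mulrC fps_scaleAr -scalerA; congr (_ *: _).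
  rewrite -(signr_odd F) -(signr_odd (fps F 1)); case: odd.
    by rewrite expr1 scaleN1r mulN1r opprK.
  by rewrite expr0 scale1r mul1r.
rewrite (eq_big_seq _ E).
have [|nbr] := boolP (b \in row_bits); last first.
  by rewrite /cut2 (negbTE nbr) mul0r scale0r big1 // => I _; case: ifP.
rewrite row_bitsE => /mapP[r rr br].
have /mapP[I Iw rI] : r.1 \in [seq map val J | J <- words] by rewrite words_val map_f.
rewrite (bigD1_seq I) ?words_uniq //= br rI eqxx big1_seq ?addr0 // => J /andP[JI Jw].
case: eqP => // e; case/eqP: JI; apply: (inj_map val_inj).
by apply: wbits_inj; rewrite ?word_row.
Qed.

Lemma Psi_unique Phi Phi' : is_Psi Phi -> is_Psi Phi' -> forall f : E16 F, Phi f = Phi' f.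
Proof.
move=> [c v0 vt] [c' v0' vt'] f; pose D : {linear E16 F -> E44 F} := (Phi \- Phi').
have Dt n : {in words, forall I, D (iota (bmul I (t_ F ^+ n))) = 0}.
  move=> I Iw; apply/eqP; rewrite subr_eq0; apply/eqP.
  have e0 : Phi (iota (gprod _ I)) = Phi' (iota (gprod _ I)).
    exact: prescribed_n0_words.
  case: n => [|n].
    rewrite expr0 (_ : bmul I 1 = gprod _ I) //.
    by apply/funext => S; apply: mul1r.
  by rewrite /bmul vt ?vt' ?word_uniq ?word_size // e0.
have DI p : {in words, forall I, D (iota (bmul I p)) = 0}.
  move=> I Iw.
  suff z i m : (D (iota (bmul I p))).1 i m = 0 /\ (D (iota (bmul I p))).2 i m = 0.
    by apply: E44_eq => i; apply/funext => m; have [] := z i m.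
  (* To reach the coefficient at [m], [p] is cut at order [M + 3]: the polynomial part is killed by
     [Dt], and iota of the rest still vanishes to order [M]. *)
  have [M DM] := adic_continuous_sub c c' (mdeg m).+1.
  have -> : D (iota (bmul I p)) = D (iota (bmul I (p - fps_head (M + 3) p))).
    apply/eqP; rewrite -subr_eq0 -!linearB subKr !linear_sum big1 // => n _.
    have DZ a q : D (iota (bmul I (a *: q))) = a *: D (iota (bmul I q)).
      by rewrite !linearZ.
    by rewrite [LHS]DZ Dt // scaler0.
  apply: DM => // S; rewrite -/(vanish M _).
  by apply: vanish_iota; apply: fps_tail.
apply/eqP; rewrite -subr_eq0 -[_ - _]/(D f); apply/eqP.
have fd : self_dual f by apply/inE16P; apply: e16P.
have -> : f = iota (cut f) by apply: val_inj; rewrite /= cut_self_dual.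
rewrite cut_words !linear_sum big1_seq // => I /andP[_ Iw]; exact: DI.
Qed.

End Uniqueness.

(** The constructions above work over any [numClosedFieldType]; the complex numbers enter only here,
    as [complex R] for a model [R] of the reals. *)
Theorem theorem4p11 (R : realType) :
  exists Psi : {linear E16 (complex R) -> E44 (complex R)},
    [/\ is_Psi Psi,
        forall Phi : {linear E16 (complex R) -> E44 (complex R)},
          is_Psi Phi -> forall f : E16 (complex R), Phi f = Psi f
      & superalgebra_embedding Psi].
Proof.
have P : is_Psi (@Psi (complex R)).
  by split; [apply: Psi_continuous | apply: Psi_n0 | apply: Psi_tn].
exists (@Psi (complex R)); split=> // [Phi PhiP f|]; first exact: Psi_unique.
by split; [apply: Psi_parity | apply: Psi_bracket | apply: Psi_injective].
Qed.
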